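(* Let $K\in\mathfrak K^h_{P_a}(X;\boldsymbol H)$, and let $K^s=K|_{X_s\times X_s}$ for $s\in S$. The following assertions are equivalent. (1) $K$ is a $\Gamma$-invariant kernel (that is, $\mathcal H_{\alpha\cdot x}=\mathcal H_x$ for all $x\in X$, $\alpha\in\Gamma_{a(x)}$, and $K(\alpha\cdot x,y)=K(x,\alpha^*\cdot y)$ for all $x,y\in X$, $\alpha\in\Gamma_{a(x)}^{a(y)}$) such that there exists $L\in\mathfrak K^+_{P_a}(X;\boldsymbol H)$ with $K\le_{P_a}L$. (2) There exists a bundle $\boldsymbol R=\{\mathcal R_{K^s}\}_{s\in S}$, where $\mathcal R_{K^s}$ is a reproducing kernel $\boldsymbol H_s$-valued Krein space with $\boldsymbol H_s$-operator valued reproducing kernel $K^s$ for all $s\in S$, and, letting $\boldsymbol D=\{\mathcal D_s\}_{s\in S}$ with $\mathcal D_s=\operatorname{Lin}\{K^s_xh\mid x\in X_s,\ h\in\mathcal H_x\}$, there exists a generalised $*$-representation $(\mathrm{Id}_S,\Phi)$, $\Phi\colon\Gamma\to\Gamma_{\boldsymbol R,\boldsymbol D}$, such that $K^{c(\alpha)}_{\alpha\cdot x}=\Phi(\alpha)K^{d(\alpha)}_x$ for all $\alpha\in\Gamma$ and $x\in X_{d(\alpha)}$. (3) There exists a quadruple $(\boldsymbol K;\boldsymbol D;\boldsymbol V;\Phi)$ with the following properties: (GIKL1) The pair $(\boldsymbol K;\boldsymbol V)$ is a Krein space minimal partial linearisation of $K$ with respect to $P_a$. (GIKL2) $(\mathrm{Id}_S;\Phi)$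 is a generalised $*$-representation of $\Gamma$ on $\Gamma_{\boldsymbol K,\boldsymbol D}$ and $\Phi(\alpha)V_x=V_{\alpha\cdot x}$ for all $x\in X$ and all $\alpha\in\Gamma_{a(x)}$.
   Context: $\mathbb F$ is $\mathbb R$ or $\mathbb C$. $\operatorname{Lin}$ denotes linear span. Semigroupoids. A semigroupoid $(\Gamma;S;d;c;\cdot)$ consists of nonempty sets $\Gamma$ and $S$ (the set of symbols), maps $d,c\colon\Gamma\to S$ (domain and codomain maps), and a product $\alpha\beta\in\Gamma$ defined whenever $d(\alpha)=c(\beta)$ (the set of such pairs is $\Gamma^{(2)}$), with $d(\alpha\beta)=d(\beta)$, $c(\alpha\beta)=c(\alpha)$, and $\alpha(\beta\gamma)=(\alpha\beta)\gamma$ whenever $d(\alpha)=c(\beta)$, $d(\beta)=c(\gamma)$. Put $\Gamma_s=\{\alpha\mid d(\alpha)=s\}$, $\Gamma^t=\{\alpha\mid c(\alpha)=t\}$, $\Gamma_s^t=\Gamma_s\cap\Gamma^t$. A $*$-semigroupoid is a semigroupoid with a map $\alpha\mapsto\alpha^*$ such that $d(\alpha^* )=c(\alpha)$, $c(\alpha^* )=d(\alpha)$, $(\alpha\beta)^*=\beta^*\alpha^*$ for $(\alpha,\beta)\in\Gamma^{(2)}$, and $(\alpha^* )^*=\alpha$. A left action $(a;\cdot)$ of $\Gamma$ on a nonempty set $X$ consists of a surjective map $a\colon X\to S$ (the anchor) and, for each $x\in X$ and $\alpha\in\Gamma_{a(x)}$, an element $\alpha\cdot x\in X$ with $a(\alpha\cdot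 x)=c(\alpha)$, such that $(\alpha\beta)\cdot x=\alpha\cdot(\beta\cdot x)$ for $(\alpha,\beta)\in\Gamma^{(2)}$, $\beta\in\Gamma_{a(x)}$. Setting. $\Gamma$ is a $*$-semigroupoid with symbol set $S$, $(a;\cdot)$ is a left action of $\Gamma$ on the nonempty set $X$, $X_s=a^{-1}(\{s\})$, $P_a=\{X_s\}_{s\in S}$. $\boldsymbol H=\{\mathcal H_x\}_{x\in X}$ is a bundle (family) of Hilbert spaces over $\mathbb F$; it is a standing assumption that $\mathcal H_{\alpha\cdot x}=\mathcal H_x$ for all $x\in X$, $\alpha\in\Gamma_{a(x)}$. $\boldsymbol H_s=\{\mathcal H_x\}_{x\in X_s}$. An $\boldsymbol H$-operator valued kernel $K$ on $X$ is a map on $X\times X$ with $K(x,y)\in\mathcal B(\mathcal H_y,\mathcal H_x)$ (bounded linear operators). $\mathfrak K^h_{P_a}(X;\boldsymbol H)$ is the real vector space of such kernels that are partially Hermitian: $K(x,y)^*=K(y,x)$ for all $s\in S$, $x,y\in X_s$. $\mathfrak K^+_{P_a}(X;\boldsymbol H)$ consists of those $K\in\mathfrak K^h_{P_a}(X;\boldsymbol H)$ with $\sum_{i,j=1}^n\langle K(x_j,x_i)h_i,h_j\rangle_{\mathcal H_{x_j}}\ge0$ for every $s\in S$, $n\in\mathbb N$, $x_1,\dots,x_n\in X_s$, $h_i\in\mathcal H_{x_i}$. $K\le_{P_a}L$ means $L-K\in\mathfrak K^+_{P_a}(X;\boldsymbol H)$. Krein spaces. A Krein space is an $\mathbb F$-vector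 space $\mathcal K$ with a (conjugate) symmetric form $[\cdot,\cdot]$, linear in the first variable, for which there is a linear operator $J$ on $\mathcal K$ (a fundamental symmetry) with $J^2=I$ such that $\langle x,y\rangle_J=[Jx,y]$ is a positive definite inner product making $\mathcal K$ a Hilbert space; all fundamental symmetries give the same (strong) topology, with respect to which boundedness, density and closures are understood. For a densely defined linear operator $T$ from $\mathcal K_1$ to $\mathcal K_2$ (Krein spaces), the Krein adjoint $T^\sharp$ has domain $\{k\in\mathcal K_2\mid\exists z\in\mathcal K_1:\ [Th,k]=[h,z]\ \forall h\in\operatorname{Dom}(T)\}$ and $T^\sharp k=z$. A reproducing kernel $\boldsymbol H_s$-valued Krein space with kernel $K^s$ is a Krein space $(\mathcal R;[\cdot,\cdot])$ such that $\mathcal R$ is a linear subspace of $\prod_{x\in X_s}\mathcal H_x$ (sections $f$ with $f(x)\in\mathcal H_x$), $K^s_xh:=K^s(\cdot,x)h\in\mathcal R$ for all $x\in X_s$, $h\in\mathcal H_x$, and $\langle f(x),h\rangle_{\mathcal H_x}=[f,K^s_xh]$ for all $f\in\mathcal R$, $x\in X_s$, $h\in\mathcal H_x$. $K^s_x$ is regarded as a linear operator $\mathcal H_x\to\mathcal R$. A Krein space partial linearisation of $K$ with respect to $P_a$ is a pair $(\boldsymbol K;\boldsymbol V)$ where $\boldsymbol K=\{\mathcal K_s\}_{s\in S}$ is a bundle of Krein spaces and $\boldsymbol V=\{V_x\}_{x\in X}$ are bounded linear operators $V_x\colon\mathcal H_x\to\mathcal K_{a(x)}$ with $\langle K(x,y)k,h\rangle_{\mathcal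 H_x}=[V_yk,V_xh]_{\mathcal K_s}$ for all $s\in S$, $x,y\in X_s$, $h\in\mathcal H_x$, $k\in\mathcal H_y$. It is minimal if each $\mathcal K_s$ is the closed span of $\{V_x\mathcal H_x\mid x\in X,\ a(x)=s\}$. Generalised representations. For a bundle of Krein spaces $\boldsymbol K=\{\mathcal K_s\}_{s\in S}$ and a bundle $\boldsymbol D=\{\mathcal D_s\}_{s\in S}$ of dense linear subspaces $\mathcal D_s\subseteq\mathcal K_s$, $\mathcal L^\sharp(\mathcal D_s,\mathcal D_t)$ is the vector space of linear operators $T\colon\mathcal D_s\to\mathcal K_t$ with $T\mathcal D_s\subseteq\mathcal D_t$, $\mathcal D_t\subseteq\operatorname{Dom}(T^\sharp)$, $T^\sharp\mathcal D_t\subseteq\mathcal D_s$. $\Gamma_{\boldsymbol K,\boldsymbol D}=\bigsqcup_{s,t\in S}\mathcal L^\sharp(\mathcal D_s,\mathcal D_t)$ is a $*$-semigroupoid under composition, with involution $T\mapsto T^\sharp|_{\mathcal D_t}$. A generalised $*$-representation $(\mathrm{Id}_S,\Phi)$ of $\Gamma$ on $\Gamma_{\boldsymbol K,\boldsymbol D}$ is a map $\Phi\colon\Gamma\to\Gamma_{\boldsymbol K,\boldsymbol D}$ with $\Phi(\alpha)\in\mathcal L^\sharp(\mathcal D_{d(\alpha)},\mathcal D_{c(\alpha)})$, $\Phi(\alpha\beta)=\Phi(\alpha)\Phi(\beta)$ on $\mathcal D_{d(\beta)}$ for $(\alpha,\beta)\in\Gamma^{(2)}$, and $\Phi(\alpha^*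 )=\Phi(\alpha)^\sharp$ on $\mathcal D_{c(\alpha)}$. The equality $\Phi(\alpha)V_x=V_{\alpha\cdot x}$ includes that the composition is defined, i.e. $V_x\mathcal H_x\subseteq\mathcal D_{a(x)}$. *)

(* Defs.v *)
From HB Require Import structures.
From mathcomp Require Import all_boot all_order all_algebra.
From mathcomp Require Import complex sesquilinear.
From mathcomp Require Import all_classical reals topology normedtype.

Set Implicit Arguments.
Unset Strict Implicit.
Unset Printing Implicit Defensive.

Import Order.TTheory GRing.Theory Num.Theory.
Import numFieldNormedType.Exports.

Local Open Scope ring_scope.
Local Open Scope classical_set_scope.
Local Open Scope complex_scope.

Variant RorC := RealScalars | ComplexScalars.

Definition scal (R : realType) (k : RorC) : numFieldType :=
  match k with RealScalars => R | ComplexScalars => R[i] end.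

Definition conjF (R : realType) (k : RorC) : scal R k -> scal R k :=
  match k with RealScalars => fun x => x | ComplexScalars => @conjc R end.

Definition reF (R : realType) (k : RorC) : scal R k -> R :=
  match k with RealScalars => fun x => x | ComplexScalars => @complex.Re R end.

Section ConjF.
Variables (R : realType) (k : RorC).

Let conjF_is_zmod_morphism : zmod_morphism (@conjF R k).
Proof. by case: k => x y //=; exact: (rmorphB (@conjc R)). Qed.

Let conjF_is_monoid_morphism : monoid_morphism (@conjF R k).
Proof.
case: k; split => // [|x y] /=; first exact: (rmorph1 (@conjc R)).
exact: (rmorphM (@conjc R)).
Qed.

HB.instance Definition _ := GRing.isZmodMorphism.Build (scal R k) (scal R k)
  (@conjF R k) conjF_is_zmod_morphism.
HB.instance Definition _ := GRing.isMonoidMorphism.Build (scal R k) (scal R k)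
  (@conjF R k) conjF_is_monoid_morphism.

End ConjF.

Section Subspaces.
Variables (F : fieldType) (V : lmodType F).

Definition subsp (D : submodClosed V) : Type := {v : V | v \in D}.

HB.instance Definition _ (D : submodClosed V) := SubChoice.on (subsp D).
HB.instance Definition _ (D : submodClosed V) :=
  [SubChoice_isSubLmodule of subsp D by <:].

Definition lin_pred (A : set V) : {pred V} := fun v =>
  `[< exists (n : nat) (c : 'I_n -> F) (w : 'I_n -> V),
        (forall i, A (w i)) /\ v = \sum_i c i *: w i >].

Lemma lin_pred_submod (A : set V) : submod_closed (lin_pred A).
Proof.
split=> [|a _ _ /asboolP[m [c [w [Aw ->]]]] /asboolP[n [d [z [Az ->]]]]].
  by apply/asboolP; exists 0, (fun=> 0), (fun=> 0); split=> [[]//|]; rewrite big_ord0.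
apply/asboolP; exists (m + n)%N.
exists (fun i => match fintype.split i with inl j => a * c j | inr j => d j end).
exists (fun i => match fintype.split i with inl j => w j | inr j => z j end).
split=> [i|]; first by case: fintype.split.
rewrite big_split_ord /= scaler_sumr; congr (_ + _); apply: eq_bigr => i _.
  by rewrite (unsplitK (inl i)) scalerA.
by rewrite (unsplitK (inr i)).
Qed.

HB.instance Definition _ (A : set V) :=
  GRing.isSubmodClosed.Build F V (lin_pred A) (lin_pred_submod A).

Definition Lin (A : set V) : submodClosed V := lin_pred A.

End Subspaces.

Section Spaces.
Variables (R : realType) (k : RorC).
Local Notation F := (scal R k).
Local Notation conj := (@conjF R k).

Section InnerProduct.
Variables (V : lmodType F) (ip : {dot V for conj}).

Definition ipnorm (x : V) : R := Num.sqrt (reF (ip x x)).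

Definition ip_complete : Prop := forall u : nat -> V,
  (forall e : R, 0 < e -> \forall m & n \near \oo, ipnorm (u m - u n) < e) ->
  exists l : V, ipnorm (u n - l) @[n --> \oo] --> (0 : R).

End InnerProduct.

Record hilbert := Hilbert {
  hcar :> lmodType F;
  hdot : {dot hcar for conj};
  hcomplete : ip_complete hdot }.

(* A fundamental symmetry [ksym] is part of the data. Which one is chosen is  *)
(* irrelevant: they all induce the same strong topology, here that of [kdot]. *)
Record krein_structure (V : lmodType F) := KreinStructure {
  kform : {hermitian_sym V for conj};
  ksym : {linear V -> V};
  ksymK : forall x, ksym (ksym x) = x;
  kdot : {dot V for conj};
  kdotE : forall x y, kdot x y = kform (ksym x) y;
  kcomplete : ip_complete kdot }.

Record krein := Krein {
  kcar :> lmodType F;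
  kstr :> krein_structure kcar }.

Definition strong_closure (K : krein) (A : set K) : set K :=
  [set x | forall e : R, 0 < e -> exists2 y, A y & ipnorm (kdot K) (x - y) < e].

Definition dense_subspace (K : krein) (D : submodClosed K) : Prop :=
  strong_closure [set` D] = setT.

Definition bounded_linear (V W : lmodType F) (ipV : {dot V for conj})
    (ipW : {dot W for conj}) (T : V -> W) : Prop :=
  linear T /\ exists C : R, forall v, ipnorm ipW (T v) <= C * ipnorm ipV v.

(* [krein_adj T x z] : x is in the domain of the Krein adjoint of T, whose    *)
(* value at x is z (unique when D is dense).                                  *)
Definition krein_adj (K1 K2 : krein) (D : submodClosed K1)
    (T : subsp D -> K2) (x : K2) (z : K1) : Prop :=
  forall h : subsp D, kform K2 (T h) x = kform K1 (val h) z.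

Definition krein_adj_dom (K1 K2 : krein) (D : submodClosed K1)
    (T : subsp D -> K2) : set K2 := [set x | exists z, krein_adj T x z].

Definition Lsharp (K1 K2 : krein) (D : submodClosed K1) (E : submodClosed K2)
    (T : {linear subsp D -> K2}) : Prop :=
  [/\ forall v, T v \in E,
      [set` E] `<=` krein_adj_dom T
    & forall x z, x \in E -> krein_adj T x z -> z \in D].

Definition hcast (H1 H2 : hilbert) (e : H1 = H2) : H1 -> H2 :=
  match e in _ = H' return H1 -> H' with erefl => fun h => h end.

End Spaces.

Record semigroupoid := Semigroupoid {
  arrow :> Type;
  symb : Type;
  arrow_inh : inhabited arrow;
  symb_inh : inhabited symb;
  dom : arrow -> symb;
  cod : arrow -> symb;
  mul : forall x y : arrow, dom x = cod y -> arrow;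
  dom_mul : forall x y (e : dom x = cod y), dom (mul e) = dom y;
  cod_mul : forall x y (e : dom x = cod y), cod (mul e) = cod x;
  mulA : forall x y z (xy : dom x = cod y) (yz : dom y = cod z)
    (x_yz : dom x = cod (mul yz)) (xy_z : dom (mul xy) = cod z),
    mul x_yz = mul xy_z }.

Record star_semigroupoid := StarSemigroupoid {
  ssgpd :> semigroupoid;
  star : ssgpd -> ssgpd;
  dom_star : forall x, dom (star x) = cod x;
  cod_star : forall x, cod (star x) = dom x;
  star_mul : forall x y (xy : dom x = cod y)
    (yx : dom (star y) = cod (star x)), star (mul xy) = mul yx;
  starK : forall x, star (star x) = x }.

Record left_action (G : semigroupoid) (X : Type) := LeftAction {
  anchor : X -> symb G;
  anchor_surj : forall s, exists x, anchor x = s;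
  act : forall (g : G) (x : X), dom g = anchor x -> X;
  anchor_act : forall g x (e : dom g = anchor x), anchor (act e) = cod g;
  act_mul : forall (g h : G) (x : X) (gh : dom g = cod h)
    (hx : dom h = anchor x) (gh_x : dom (mul gh) = anchor x)
    (g_hx : dom g = anchor (act hx)), act gh_x = act g_hx }.

Definition homset (G : semigroupoid) (s t : symb G) : Type :=
  {g : G | dom g = s /\ cod g = t}.

Section Hom.
Variables (G : star_semigroupoid) (r s t : symb G).

Lemma hom_composable (g : homset s t) (h : homset r s) :
  dom (sval g) = cod (sval h).
Proof. by rewrite (svalP g).1 (svalP h).2. Qed.

Lemma hmul_subproof (g : homset s t) (h : homset r s) :
  dom (mul (hom_composable g h)) = r /\ cod (mul (hom_composable g h)) = t.
Proof. by rewrite dom_mul cod_mul (svalP h).1 (svalP g).2. Qed.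

Definition hmul (g : homset s t) (h : homset r s) : homset r t :=
  exist _ (mul (hom_composable g h)) (hmul_subproof g h).

Lemma hstar_subproof (g : homset s t) :
  dom (star (sval g)) = t /\ cod (star (sval g)) = s.
Proof. by rewrite dom_star cod_star (svalP g).1 (svalP g).2. Qed.

Definition hstar (g : homset s t) : homset t s :=
  exist _ (star (sval g)) (hstar_subproof g).

End Hom.

Section Action.
Variables (G : semigroupoid) (X : Type) (A : left_action G X).

Definition fiber (s : symb G) : Type := {x : X | anchor A x = s}.

Lemma hom_acts (s t : symb G) (g : homset s t) (x : fiber s) :
  dom (sval g) = anchor A (sval x).
Proof. by rewrite (svalP g).1 (svalP x). Qed.

Lemma fact_subproof (s t : symb G) (g : homset s t) (x : fiber s) :
  anchor A (act (hom_acts g x)) = t.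
Proof. by rewrite anchor_act (svalP g).2. Qed.

Definition fact (s t : symb G) (g : homset s t) (x : fiber s) : fiber t :=
  exist _ (act (hom_acts g x)) (fact_subproof g x).

End Action.

Section Kernels.
Variables (R : realType) (k : RorC) (G : star_semigroupoid) (X : Type).
Variables (A : left_action G X) (H : X -> hilbert R k).
Local Notation F := (scal R k).
Local Notation fiber := (fiber A).

Definition kernel_family : Type := forall x y : X, H y -> H x.

Implicit Types K L : kernel_family.

Definition operator_valued K : Prop :=
  forall x y, bounded_linear (hdot (H y)) (hdot (H x)) (K x y).

Definition partially_hermitian K : Prop :=
  operator_valued K /\
  forall s (x y : fiber s) (h : H (sval x)) (h' : H (sval y)),
    hdot (H (sval x)) (K (sval x) (sval y) h') h =
    hdot (H (sval y)) h' (K (sval y) (sval x) h).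

Definition partially_positive K : Prop :=
  partially_hermitian K /\
  forall s (n : nat) (x : 'I_n -> fiber s) (h : forall i, H (sval (x i))),
    0 <= \sum_i \sum_j hdot (H (sval (x j)))
                         (K (sval (x j)) (sval (x i)) (h i)) (h j).

Definition kernel_le K L : Prop :=
  partially_positive (fun x y h => L x y h - K x y h).

Definition bundle_invariant : Prop :=
  forall s t (g : homset s t) (x : fiber s), H (sval (fact g x)) = H (sval x).

Definition kernel_invariant (eH : bundle_invariant) K : Prop :=
  forall s t (g : homset s t) (x : fiber s) (y : fiber t) (h : H (sval y)),
    hcast (eH s t g x) (K (sval (fact g x)) (sval y) h) =
    K (sval x) (sval (fact (hstar g) y)) (hcast (esym (eH t s (hstar g) y)) h).

Definition sections (s : symb G) : Type := forall x : fiber s, H (sval x).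

Section SectionsLmodule.
Variable s : symb G.
Implicit Types f g h : sections s.

HB.instance Definition _ := gen_eqMixin (sections s).
HB.instance Definition _ := gen_choiceMixin (sections s).

Let addf f g : sections s := fun x => f x + g x.
Let oppf f : sections s := fun x => - f x.
Let scalef (a : F) f : sections s := fun x => a *: f x.

Let addfA : associative addf.
Proof. by move=> f g h; apply: functional_extensionality_dep => x; exact: addrA. Qed.
Let addfC : commutative addf.
Proof. by move=> f g; apply: functional_extensionality_dep => x; exact: addrC. Qed.
Let add0f : left_id (fun=> 0) addf.
Proof. by move=> f; apply: functional_extensionality_dep => x; exact: add0r. Qed.
Let addNf : left_inverse (fun=> 0) oppf addf.
Proof. by move=> f; apply: functional_extensionality_dep => x; exact: addNr. Qed.

HB.instance Definition _ :=
  GRing.isZmodule.Build (sections s) addfA addfC add0f addNf.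

Let scalefA a b f : scalef a (scalef b f) = scalef (a * b) f.
Proof. by apply: functional_extensionality_dep => x; exact: scalerA. Qed.
Let scale1f : left_id 1 scalef.
Proof. by move=> f; apply: functional_extensionality_dep => x; exact: scale1r. Qed.
Let scalefDr : right_distributive scalef +%R.
Proof. by move=> a f g; apply: functional_extensionality_dep => x; exact: scalerDr. Qed.
Let scalefDl f : {morph scalef^~ f : a b / a + b}.
Proof. by move=> a b; apply: functional_extensionality_dep => x; exact: scalerDl. Qed.

HB.instance Definition _ := GRing.Zmodule_isLmodule.Build F (sections s)
  scalefA scale1f scalefDr scalefDl.

End SectionsLmodule.

Definition kernel_section K s (x : fiber s) (h : H (sval x)) : sections s :=
  fun y => K (sval y) (sval x) h.

Record rk_krein K (s : symb G) := RKKrein {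
  rk_space : submodClosed (sections s);
  rk_str : krein_structure (subsp rk_space);
  rk_mem : forall (x : fiber s) (h : H (sval x)),
    kernel_section K h \in rk_space;
  rk_reproducing : forall (f : subsp rk_space) (x : fiber s) (h : H (sval x)),
    hdot (H (sval x)) (val f x) h =
    kform rk_str f (exist _ (kernel_section K h) (rk_mem h)) }.

Definition krein_of_rk K s (RK : rk_krein K s) : krein R k := Krein (rk_str RK).

Definition rk_section K s (RK : rk_krein K s) (x : fiber s) (h : H (sval x)) :
    krein_of_rk RK :=
  exist _ (kernel_section K h) (rk_mem RK h).

Section Representations.
Variable KS : symb G -> krein R k.

Definition operator_bundle : Type :=
  forall (s : symb G) (x : fiber s), H (sval x) -> KS s.

Definition range_span (V : operator_bundle) (s : symb G) : submodClosed (KS s) :=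
  Lin [set v | exists (x : fiber s) (h : H (sval x)), v = V s x h].

Definition krein_linearisation K (V : operator_bundle) : Prop :=
  (forall s (x : fiber s),
     bounded_linear (hdot (H (sval x))) (kdot (KS s)) (V s x)) /\
  forall s (x y : fiber s) (h : H (sval x)) (h' : H (sval y)),
    hdot (H (sval x)) (K (sval x) (sval y) h') h =
    kform (KS s) (V s y h') (V s x h).

Definition minimal_linearisation (V : operator_bundle) : Prop :=
  forall s, strong_closure [set` range_span V s] = setT.

Variable D : forall s, submodClosed (KS s).

Definition gen_star_representation
    (Phi : forall s t, homset s t -> {linear subsp (D s) -> KS t}) : Prop :=
  [/\ forall s, dense_subspace (D s),
      forall s t (g : homset s t), Lsharp (D t) (Phi s t g),
      forall r s t (g : homset s t) (h : homset r s) (v : subsp (D r))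
        (w : subsp (D s)),
        val w = Phi r s h v -> Phi r t (hmul g h) v = Phi s t g w
    & forall s t (g : homset s t) (v : subsp (D t)),
        krein_adj (Phi s t g) (val v) (Phi t s (hstar g) v)].

(* Phi(g) V_x = V_(g.x), including that V_x takes its values in the domain of *)
(* Phi(g).                                                                    *)
Definition intertwines (eH : bundle_invariant) (V : operator_bundle)
    (Phi : forall s t, homset s t -> {linear subsp (D s) -> KS t}) : Prop :=
  forall s t (g : homset s t) (x : fiber s) (h : H (sval x)),
    exists2 v : subsp (D s), val v = V s x h &
      Phi s t g v = V t (fact g x) (hcast (esym (eH s t g x)) h).

End Representations.

End Kernels.

(* Main.v *)
Require Import Defs.
From HB Require Import structures.
From mathcomp Require Import all_boot all_order all_algebra.
From mathcomp Require Import complex sesquilinear ring lra.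
From mathcomp Require Import all_classical reals topology normedtype.

Set Implicit Arguments.
Unset Strict Implicit.
Unset Printing Implicit Defensive.

Import Order.TTheory GRing.Theory Num.Theory.
Import numFieldNormedType.Exports.

Local Open Scope ring_scope.
Local Open Scope classical_set_scope.

(** The work is in producing a Krein space out of a Hermitian kernel K with
    K <= L, L >= 0, and it takes place on one fibre at a time.

    Write V for the space of formal finite sums of pairs (x, h); then K and L
    become Hermitian forms b and l on V with |b(v, v)| <= q0(v) for the
    quadratic form q0 of 2L - K.  A Krein space with Gram form b would normally
    be obtained from the polar decomposition of the Gram operator.  Instead,
    Zorn's lemma gives a minimal quadratic form q with |b| <= q <= q0.  For any
    such q the conjugate q'(v) = sup_w (2 Re b(v, w) - q(w)) is at most q, and
    (q + q')/2 is again an admissible form, because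
    q'(v) >= 2 |b(v, v)| - q(v); minimality therefore forces q' = q
    (selfconjugate_majorant).  This says that b is an isometry from (V, q) into
    its dual: in the Hilbert space of q-bounded conjugate-linear functionals,
    the map J with (J f)(w) = <f, b(w, .)> exchanges q(v, .) with b(v, .), so
    that J^2 = 1, and J is the fundamental symmetry of a Krein space in which
    [f, b(v, .)] = f(v) (krein_completion).  By the Riesz theorem in the spaces
    H_x these functionals are sections, and one has the reproducing kernel
    Krein space of K, in which the kernel sections are dense
    (rk_krein_exists).

    Given these spaces, invariance of K says that the translation
    (g f)(y) = f(g^* . y) of sections maps K_x h to K_(g.x) h; restricted to the
    spans of kernel sections, translations are the required representation
    (rk_representation_exists).

    A reproducing kernel space is itself a minimal linearisation, where the
    boundedness of the maps h |-> K_x h follows from the uniform boundedness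
    principle, as they have everywhere defined adjoints (hellinger_toeplitz).
    Conversely, a linearisation V has V_(g.x) = Phi(g) V_x, and moving Phi(g)
    across the form gives invariance; and L(x, y) = V_x^* V_y, with the Hilbert
    adjoint for a fundamental symmetry J, is a positive kernel above K because
    2 (<u, u>_J - [u, u]) = <u - J u, u - J u>_J. *)

(** * Linear spans and linear maps *)

Section Spans.
Variables (F : fieldType) (V : lmodType F) (A : set V).

Lemma mem_Lin v : A v -> v \in Lin A.
Proof.
move=> Av; apply/asboolP; exists 1, (fun=> 1), (fun=> v); split=> //.
by rewrite big_ord1 scale1r.
Qed.

Lemma Lin_ind (P : V -> Prop) :
  P 0 -> (forall c u v, P u -> P v -> P (c *: u + v)) -> (forall v, A v -> P v) ->
  forall v, v \in Lin A -> P v.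
Proof.
move=> P0 PD PA v /asboolP[n [c [w [Aw ->]]]].
elim/big_rec: _ => // i u _ Pu; apply: PD => //; exact: PA.
Qed.

Lemma subsp_linearP (D : submodClosed V) c (u v : subsp D) :
  val (c *: u + v) = c *: val u + val v.
Proof. by []. Qed.

Lemma subsp_Lin_ind (P : subsp (Lin A) -> Prop) :
  P 0 -> (forall c u v, P u -> P v -> P (c *: u + v)) ->
  (forall v, A (val v) -> P v) -> forall v, P v.
Proof.
move=> P0 PD PA v.
have P_irr (u w : subsp (Lin A)) : val u = val w -> P u -> P w.
  by move=> /val_inj ->.
suff [vA Pv] : exists vA : val v \in Lin A, P (exist _ (val v) vA).
  exact: P_irr Pv.
apply: (@Lin_ind (fun w => exists wA : w \in Lin A, P (exist _ w wA))).
- by exists (valP (0 : subsp (Lin A))); exact: P_irr P0.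
- move=> c u w [uA Pu] [wA Pw].
  exists (valP (c *: (exist _ u uA : subsp (Lin A)) + exist _ w wA)).
  exact: P_irr (PD c _ _ Pu Pw).
- by move=> w Aw; exists (mem_Lin Aw); exact: PA.
- exact: valP.
Qed.

End Spans.

Definition linear_of (F : fieldType) (U V : lmodType F) (f : U -> V)
    (hf : linear f) : {linear U -> V} :=
  HB.pack f (GRing.isLinear.Build F U V *:%R f hf).

Lemma fct_linearP (F : fieldType) (T : Type) (W : lmodType F) (c : F)
    (f g : T -> W) t :
  (c *: f + g) t = c *: f t + g t.
Proof. by []. Qed.

(** * The scalar field *)

Section Scalars.
Variables (R : realType) (k : RorC).
Local Notation F := (scal R k).
Local Notation conj := (@conjF R k).
Implicit Types (r : R) (a c z : F).

Definition ofR : R -> F :=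
  match k return R -> scal R k with
  | RealScalars => fun r => r
  | ComplexScalars => fun r => r%:C%C
  end.

Lemma reF_zmod_morphism : zmod_morphism (@reF R k).
Proof. by case: k => x y //=; case: x; case: y. Qed.

HB.instance Definition _ := GRing.isZmodMorphism.Build (scal R k) R
  (@reF R k) reF_zmod_morphism.

Lemma reF_ofRM r z : reF (ofR r * z) = r * reF z.
Proof. by rewrite /ofR; case: k z => //= -[x y] /=; rewrite mul0r subr0. Qed.

Lemma reF_ofR r : reF (ofR r) = r.
Proof. by rewrite /ofR; case: k. Qed.

Lemma ofR_zmod_morphism : zmod_morphism ofR.
Proof. by rewrite /ofR; case: k => x y //=; rewrite rmorphB. Qed.

Lemma ofR_monoid_morphism : monoid_morphism ofR.
Proof. by rewrite /ofR; case: k => /=; split=> // x y; rewrite rmorphM. Qed.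

HB.instance Definition _ := GRing.isZmodMorphism.Build R (scal R k)
  ofR ofR_zmod_morphism.
HB.instance Definition _ := GRing.isMonoidMorphism.Build R (scal R k)
  ofR ofR_monoid_morphism.

Lemma conjFK : involutive conj.
Proof. by case: k => //= -[x y] /=; rewrite opprK. Qed.

Lemma reF_conj z : reF (conj z) = reF z.
Proof. by case: k z => //= -[]. Qed.

Lemma conj_ofR r : conj (ofR r) = ofR r.
Proof. by rewrite /ofR; case: k => //=; rewrite oppr0. Qed.

Definition abs2 z : R := reF (z * conj z).

Lemma mul_conjF z : z * conj z = ofR (abs2 z).
Proof.
rewrite /abs2 /ofR; case: k z => //= -[x y] /=.
by apply/eqP; rewrite eq_complex /= eqxx /=; apply/eqP; ring.
Qed.

Lemma abs2_ge0 z : 0 <= abs2 z.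
Proof.
rewrite /abs2; case: k z => //= [x|[x y] /=]; first by rewrite -expr2 sqr_ge0.
by rewrite mulrN opprK addr_ge0 // -expr2 sqr_ge0.
Qed.

Lemma abs2_eq0 z : abs2 z = 0 -> z = 0.
Proof.
move=> z0; have := mul_conjF z; rewrite z0 rmorph0 => /eqP.
by rewrite mulf_eq0 => /orP[/eqP //|]; rewrite fmorph_eq0 => /eqP.
Qed.

Lemma abs2_ofR r : abs2 (ofR r) = r ^+ 2.
Proof. by rewrite /abs2 conj_ofR -rmorphM reF_ofR. Qed.

Lemma abs2M a c : abs2 (a * c) = abs2 a * abs2 c.
Proof.
by apply: (fmorph_inj ofR); rewrite [RHS]rmorphM /= -!mul_conjF rmorphM mulrACA.
Qed.

Lemma abs2V c : c != 0 -> abs2 c * abs2 c^-1 = 1.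
Proof. by move=> c0; rewrite -abs2M divff // -(rmorph1 ofR) abs2_ofR expr1n. Qed.

(** Applied to c and to c^-1, the inequality gives both halves of the equality. *)
Lemma abs2_homogeneous (V : lmodType F) (q : V -> R) :
  q 0 = 0 -> (forall c v, q (c *: v) <= abs2 c * q v) ->
  forall c v, q (c *: v) = abs2 c * q v.
Proof.
move=> q0 q_le c v; apply/eqP; rewrite eq_le q_le /=.
have [->|c0] := eqVneq c 0; first by rewrite scale0r q0 /abs2 mul0r raddf0 mul0r.
have := ler_wpM2l (abs2_ge0 c) (q_le c^-1 (c *: v)).
by rewrite scalerK // mulrA abs2V // mul1r.
Qed.

Lemma conjF_fixed z : conj z = z -> z = ofR (reF z).
Proof.
rewrite /ofR; case: k z => //= -[x y] /= [] yE; congr Complex.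
lra.
Qed.

Lemma ofR_gt0 r : (0 < ofR r) = (0 < r).
Proof. by rewrite /ofR; case: k => //=; rewrite ltcR. Qed.

Lemma reF_ge0 z : 0 <= z -> 0 <= reF z.
Proof. by case: k z => //= -[x y]; rewrite lecE /= => /andP[]. Qed.

Lemma reF_gt0 z : 0 < z -> 0 < reF z.
Proof. by case: k z => //= -[x y]; rewrite ltcE /= => /andP[]. Qed.

Lemma reF_nondegenerate z : (forall c, reF (c * z) = 0) -> z = 0.
Proof. by move=> /(_ (conj z)); rewrite mulrC => /abs2_eq0. Qed.

(** Real-linear functionals on F are the maps c |-> Re (c z). *)
Lemma reF_represent (phi : F -> R) :
  (forall a c, phi (a + c) = phi a + phi c) ->
  (forall r a, phi (ofR r * a) = r * phi a) ->
  exists z, forall c, phi c = reF (c * z).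
Proof.
rewrite /ofR; case: k phi => //= phi phiD phiZ.
  by exists (phi 1) => c; rewrite -phiZ mulr1.
exists (Complex (phi 1) (- phi 'i%C)) => -[x y] /=.
have -> : Complex x y = x%:C%C * 1 + y%:C%C * 'i%C.
  by rewrite mulr1; apply/eqP; rewrite eq_complex /=; apply/andP; split; apply/eqP; ring.
rewrite phiD !phiZ; lra.
Qed.

End Scalars.

(** * Real parts of sesquilinear forms *)

Section Forms.
Variables (R : realType) (k : RorC).
Local Notation F := (scal R k).
Local Notation conj := (@conjF R k).
Local Notation ofR := (@ofR R k).
Implicit Types (r : R) (c : F).

Definition real_linear (V : lmodType F) (phi : V -> R) : Prop :=
  (forall u v, phi (u + v) = phi u + phi v) /\
  (forall r v, phi (ofR r *: v) = r * phi v).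

(** The functions Re f for a form f that is linear in its first and
    conjugate-linear in its second variable; complexify recovers f.  All the
    analysis below is done on these real parts, where suprema and infima are
    available. *)
Record balanced (U V : lmodType F) (B : U -> V -> R) : Prop := Balanced {
  balDl : forall u u' v, B (u + u') v = B u v + B u' v;
  balDr : forall u v v', B u (v + v') = B u v + B u v';
  balRl : forall r u v, B (ofR r *: u) v = r * B u v;
  balC : forall c u v, B (c *: u) v = B u (conj c *: v) }.

Section BalancedTheory.
Variables (U V : lmodType F) (B : U -> V -> R).
Hypothesis hB : balanced B.

Lemma balRr r u v : B u (ofR r *: v) = r * B u v.
Proof. by rewrite -(balRl hB) (balC hB) conj_ofR. Qed.

Lemma bal0l v : B 0 v = 0.
Proof. by rewrite -(scale0r 0) -(rmorph0 ofR) (balRl hB) mul0r. Qed.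

Lemma bal0r u : B u 0 = 0.
Proof. by rewrite -(scale0r 0) -(rmorph0 ofR) balRr mul0r. Qed.

Lemma balNl u v : B (- u) v = - B u v.
Proof. by rewrite -scaleN1r -(rmorph1 ofR) -rmorphN (balRl hB) mulN1r. Qed.

Lemma balNr u v : B u (- v) = - B u v.
Proof. by rewrite -scaleN1r -(rmorph1 ofR) -rmorphN balRr mulN1r. Qed.

Lemma balBl u u' v : B (u - u') v = B u v - B u' v.
Proof. by rewrite (balDl hB) balNl. Qed.

Lemma balBr u v v' : B u (v - v') = B u v - B u v'.
Proof. by rewrite (balDr hB) balNr. Qed.

Lemma balZZ c u v : B (c *: u) (c *: v) = abs2 c * B u v.
Proof. by rewrite (balC hB) scalerA mulrC mul_conjF balRr. Qed.

Lemma bal_real_linear u : real_linear (B u).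
Proof. by split=> [v w|r v]; [exact: balDr|exact: balRr]. Qed.

Lemma complexify : exists f : U -> V -> F,
  forall c u v, reF (c * f u v) = B (c *: u) v.
Proof.
suff /choice[f fE] u : exists f : V -> F,
    forall v c, reF (c * f v) = B (c *: u) v by exists f => c u v; exact: fE.
suff /choice[f fE] v : exists z : F, forall c, reF (c * z) = B (c *: u) v.
  by exists f.
have [|r c|z zE] := reF_represent (phi := fun c => B (c *: u) v).
- by move=> a c; rewrite scalerDl (balDl hB).
- by rewrite -scalerA (balRl hB).
by exists z => c; rewrite zE.
Qed.

End BalancedTheory.

Lemma reF_ext (x y : F) : (forall c, reF (c * x) = reF (c * y)) -> x = y.
Proof.
move=> xy; apply/eqP; rewrite -subr_eq0; apply/eqP/reF_nondegenerate => c.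
by rewrite mulrBr raddfB /= xy subrr.
Qed.

Section Hermitian.
Variables (E : lmodType F) (B : E -> E -> R).
Hypotheses (hB : balanced B) (symB : forall u v, B u v = B v u).

(** The real part of f (c *: u) v for all scalars c determines f u v, so that
    linearity and symmetry of f are inherited from B. *)
Lemma hermitian_form : exists f : {hermitian_sym E for conj},
  forall u v, reF (f u v) = B u v.
Proof.
have [f fE] := complexify hB.
have fC u v : f u v = conj (f v u).
  apply: reF_ext => c; rewrite fE -{2}[c]conjFK -rmorphM reF_conj fE.
  by rewrite [RHS]symB (balC hB).
have fl v : GRing.linear_for ( *%R : F -> F -> F) (f ^~ v).
  move=> a u w; apply: reF_ext => c.
  by rewrite fE scalerDr (balDl hB) scalerA mulrDr mulrA raddfD /= !fE.
have fr u : GRing.linear_for (conj \; *%R) (f u).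
  move=> a v w; rewrite fC fl rmorphD rmorphM /= -fC; congr (_ * _ + _).
  by rewrite -fC.
pose g : {hermitian_sym E for conj} := HB.pack f
  (bilinear_isBilinear.Build F E E F ( *%R : F -> F -> F) (conj \; *%R) f (fl, fr))
  (isHermitianSesquilinear.Build F E false conj f
     (fun u v => etrans (fC u v) (esym (mul1r _)))).
by exists g => u v; have := fE 1 u v; rewrite mul1r scale1r.
Qed.

Lemma dot_form : (forall u, u != 0 -> 0 < B u u) ->
  exists f : {dot E for conj}, forall u v, reF (f u v) = B u v.
Proof.
move=> posB; have [f fE] := hermitian_form.
have f_gt0 u : u != 0 -> 0 < f u u.
  move=> /posB u_gt0; rewrite [f u u]conjF_fixed ?fE ?ofR_gt0 //.
  by rewrite {2}[f u u]hermC expr0 mul1r.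
pose g : {dot E for conj} :=
  HB.pack (f : E -> E -> F) (Hermitian.class f) (isDotProduct.Build F E f f_gt0).
by exists g => u v; rewrite -fE.
Qed.

End Hermitian.

Lemma hermitian_balanced (E : lmodType F) (f : {hermitian_sym E for conj}) :
  balanced (fun u v => reF (f u v)).
Proof.
split=> [u u' v|u v v'|r u v|c u v].
- by rewrite linearDl raddfD.
- by rewrite linearDr raddfD.
- by rewrite linearZl_LR reF_ofRM.
- by rewrite linearZl_LR linearZr_LR /= conjFK.
Qed.

Lemma reF_hermC (E : lmodType F) (f : {hermitian_sym E for conj}) u v :
  reF (f u v) = reF (f v u).
Proof. by rewrite hermC expr0 mul1r reF_conj. Qed.

End Forms.

(** * Quadratic forms, their conjugates, and self-conjugate majorants *)

Section QuadraticForms.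
Variables (R : realType) (k : RorC).
Local Notation F := (scal R k).
Local Notation conj := (@conjF R k).
Local Notation ofR := (@ofR R k).

(** Squares of Hilbert seminorms.  One inequality of the parallelogram law
    suffices, the other one being its instance at u + v and u - v; suprema and
    infima of such functions only give the inequality directly. *)
Record quadratic (V : lmodType F) (q : V -> R) : Prop := Quadratic {
  quadZ : forall (c : F) v, q (c *: v) = abs2 c * q v;
  quad_ge0 : forall v, 0 <= q v;
  quad_par_le : forall u v, q (u + v) + q (u - v) <= 2 * (q u + q v) }.

Definition polar (V : lmodType F) (q : V -> R) (u v : V) : R :=
  (q (u + v) - q u - q v) / 2.

(** The difference phi t - t * phi 1 is additive and has period 1, so it is
    bounded on the line; a bounded additive function vanishes. *)
Lemma additive_bounded_linear (phi : R -> R) (C D : R) :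
  (forall s t, phi (s + t) = phi s + phi t) ->
  (forall t, `|phi t| <= C * t ^+ 2 + D) -> forall t, phi t = t * phi 1.
Proof.
move=> phiD phi_le.
have phi_zmod : zmod_morphism (fun t => phi t - t * phi 1).
  have phi0 : phi 0 = 0 by have := phiD 0 0; rewrite addr0; lra.
  have phiN t : phi (- t) = - phi t by have := phiD t (- t); rewrite subrr; lra.
  by move=> s t; rewrite phiD phiN; ring.
have [psi psiE] : exists psi : {additive R -> R},
    forall t, psi t = phi t - t * phi 1.
  pose psi : {additive R -> R} := HB.pack (fun t => phi t - t * phi 1)
    (GRing.isZmodMorphism.Build R R _ phi_zmod).
  by exists psi.
suff psi0 t : psi t = 0 by move=> t; have := psi0 t; rewrite psiE; lra.
pose M := `|C| + `|D| + `|phi 1|.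
have psi1 : psi 1 = 0 by rewrite psiE mul1r subrr.
have psi_le s : 0 <= s < 1 -> `|psi s| <= M.
  move=> /andP[s0 s1]; rewrite psiE (le_trans (ler_normB _ _)) // /M.
  apply: lerD; last by rewrite normrM ler_piMl // ger0_norm // ltW.
  apply: le_trans (phi_le s) _; apply: lerD; last exact: ler_norm.
  have s2 : 0 <= s ^+ 2 <= 1 by rewrite sqr_ge0 /=; nra.
  case/andP: s2 => s20 s21.
  by apply: le_trans (ler_norm _) _; rewrite normrM (ger0_norm s20) ler_piMr.
have psi_nat n : `|psi t| *+ n <= M.
  rewrite -normrMn -raddfMn.
  have -> : psi (t *+ n) = psi (t *+ n - (Num.floor (t *+ n))%:~R).
    by rewrite raddfB raddfMz psi1 mul0rz subr0.
  apply: psi_le; rewrite subr_ge0 floor_le /=.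
  by have := floorD1_gt (t *+ n); rewrite intrD1; lra.
apply/eqP; apply: contraT => t0.
have tpos : 0 < `|psi t| by rewrite normr_gt0.
have := psi_nat (Num.truncn (M / `|psi t|)).+1.
have := truncnS_gt (M / `|psi t|).
by rewrite ltr_pdivrMr // mulr_natl => /lt_le_trans h /h; rewrite ltxx.
Qed.

Section JordanVonNeumann.
Variables (V : lmodType F) (q : V -> R).
Hypothesis hq : quadratic q.

Lemma quad0 : q 0 = 0.
Proof.
by rewrite -(scale0r (0 : V)) (quadZ hq) /abs2 mul0r raddf0 mul0r.
Qed.

Lemma quadN v : q (- v) = q v.
Proof.
rewrite -scaleN1r (quadZ hq) -(rmorph1 ofR) -rmorphN abs2_ofR.
by rewrite sqrrN expr1n mul1r.
Qed.

Lemma quadR r v : q (ofR r *: v) = r ^+ 2 * q v.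
Proof. by rewrite (quadZ hq) abs2_ofR. Qed.

Lemma quad_par u v : q (u + v) + q (u - v) = 2 * (q u + q v).
Proof.
apply/eqP; rewrite eq_le (quad_par_le hq) /=.
have two w : w + w = ofR 2 *: w :> V.
  by rewrite -[2]/(1 + 1) rmorphD rmorph1 scalerDl scale1r.
have := quad_par_le hq (u + v) (u - v).
have -> : u + v + (u - v) = u + u by rewrite addrACA subrr addr0.
have -> : u + v - (u - v) = v + v by rewrite opprB [u + v]addrC addrACA subrr addr0.
by rewrite !two !quadR; lra.
Qed.

Lemma polarC u v : polar q u v = polar q v u.
Proof. by rewrite /polar [u + v]addrC; lra. Qed.

Lemma polarE v : polar q v v = q v.
Proof.
have two w : w + w = ofR 2 *: w :> V.
  by rewrite -[2]/(1 + 1) rmorphD rmorph1 scalerDl scale1r.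
by rewrite /polar two quadR; lra.
Qed.

Lemma quadD u v : q (u + v) = q u + 2 * polar q u v + q v.
Proof. by rewrite /polar; lra. Qed.

(** The Jordan-von Neumann argument: four instances of the parallelogram law. *)
Lemma polarDl u u' v : polar q (u + u') v = polar q u v + polar q u' v.
Proof.
have e1 : u + v + u' = u + u' + v by rewrite addrAC.
have e2 : u' + v + u = u + u' + v by rewrite addrC addrA.
have e3 : u + v - u' = v + (u - u') by rewrite [u + v]addrC addrA.
have e4 : u' + v - u = v - (u - u') by rewrite opprB [u' + v]addrC addrA.
have := quad_par (u + v) u'; have := quad_par (u' + v) u.
have := quad_par v (u - u'); have := quad_par u u'.
by rewrite e1 e2 e3 e4 /polar; lra.
Qed.

Lemma polar_le u v : `|2 * polar q u v| <= q u + q v.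
Proof.
have polarNr : polar q u (- v) = - polar q u v.
  have := polarDl v (- v) u; rewrite subrr ![polar q _ u]polarC.
  have -> : polar q u 0 = 0 by rewrite /polar addr0 quad0; lra.
  lra.
have := quad_ge0 hq (u + v); have := quad_ge0 hq (u - v).
by rewrite !quadD polarNr quadN ler_norml => *; apply/andP; split; lra.
Qed.

(** Real homogeneity comes from additivity and the bound polar_le; the
    remaining law follows from q (c *: v) = |c|^2 q v by writing
    conj c *: v = |c|^2 *: (c^-1 *: v). *)
Lemma polar_balanced : balanced (polar q).
Proof.
have polarRl r u v : polar q (ofR r *: u) v = r * polar q u v.
  rewrite -[u in RHS]scale1r -(rmorph1 ofR).
  apply: (@additive_bounded_linear (fun t => polar q (ofR t *: u) v)
    (q u / 2) (q v / 2)) => [s t|t]; first by rewrite rmorphD scalerDl polarDl.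
  have := polar_le (ofR t *: u) v; rewrite quadR normrM ger0_norm //; lra.
have polarRr r u v : polar q u (ofR r *: v) = r * polar q u v.
  by rewrite polarC polarRl polarC.
split; [exact: polarDl| |exact: polarRl|move=> c u v].
  by move=> u v v'; rewrite polarC polarDl ![polar q _ u]polarC.
have [->|c0] := eqVneq c 0.
  by rewrite rmorph0 !scale0r /polar add0r addr0 quad0 !subr0 !subrr.
have -> : conj c *: v = ofR (abs2 c) *: (c^-1 *: v).
  by rewrite -mul_conjF scalerA mulrAC divff // mul1r.
rewrite polarRr -{1}[v](scalerKV c0).
by rewrite /polar -scalerDr !(quadZ hq); lra.
Qed.

End JordanVonNeumann.

Lemma diag_par (V : lmodType F) (B : V -> V -> R) u v : balanced B ->
  B (u + v) (u + v) + B (u - v) (u - v) = 2 * (B u u + B v v).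
Proof.
move=> hB; rewrite !(balDl hB) !(balDr hB) !(balNl hB) !(balNr hB); lra.
Qed.

Lemma quadratic_diag (V : lmodType F) (B : V -> V -> R) :
  balanced B -> (forall v, 0 <= B v v) -> quadratic (fun v => B v v).
Proof.
by move=> hB B0; split=> // [c v|u v]; [exact: balZZ|rewrite diag_par].
Qed.

Lemma polar_diag (V : lmodType F) (B : V -> V -> R) u v :
  balanced B -> (forall u v, B u v = B v u) ->
  polar (fun v => B v v) u v = B u v.
Proof.
move=> hB symB; rewrite /polar (balDl hB) !(balDr hB) [B v u]symB; lra.
Qed.

Section Conjugate.
Variables (V : lmodType F) (q : V -> R).
Implicit Types phi : V -> R.

(** The Legendre transform.  When q is the square of a seminorm this is the
    square of the dual norm of phi, and dominated says that it is finite. *)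
Definition conjugate phi : R := sup [set 2 * phi v - q v | v in setT].

Definition dominated phi : Prop := exists C, forall v, 2 * phi v - q v <= C.

Lemma conjugate_ub phi v : dominated phi -> 2 * phi v - q v <= conjugate phi.
Proof.
move=> [C phiC]; apply: ub_le_sup; last by exists v.
by exists C => _ [w _ <-].
Qed.

Lemma conjugate_le phi C :
  (forall v, 2 * phi v - q v <= C) -> conjugate phi <= C.
Proof.
by move=> phiC; apply: ge_sup => [|_ [v _ <-]//]; exists (2 * phi 0 - q 0), 0.
Qed.

Lemma conjugate_approx phi e : 0 < e ->
  dominated phi -> exists v, conjugate phi - e < 2 * phi v - q v.
Proof.
move=> e0 [C phiC].
have hs : has_sup [set 2 * phi v - q v | v in setT].
  by split; [exists (2 * phi 0 - q 0), 0|exists C => _ [v _ <-]].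
by have [_ [v _ <-] h] := sup_adherent e0 hs; exists v.
Qed.

Hypothesis hq : quadratic q.

Lemma conjugate_ge0 phi : real_linear phi -> dominated phi -> 0 <= conjugate phi.
Proof.
move=> [phiD _] dom; have := conjugate_ub 0 dom; rewrite (quad0 hq).
by have := phiD 0 0; rewrite addr0; lra.
Qed.

(** The bound of phi by its dual norm, in the weighted form that avoids square roots. *)
Lemma conjugate_bound phi v e : real_linear phi -> dominated phi ->
  0 < e -> 2 * phi v <= e * conjugate phi + e^-1 * q v.
Proof.
move=> [_ phiZ] dom e0; have := conjugate_ub (ofR e^-1 *: v) dom.
rewrite phiZ (quadR hq); set s := conjugate phi => h.
have := ler_wpM2l (ltW e0) h.
have -> : e * (2 * (e^-1 * phi v) - e^-1 ^+ 2 * q v) = 2 * phi v - e^-1 * q v.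
  by field; rewrite gt_eqF.
lra.
Qed.

Variables (U : lmodType F) (p : U -> V -> R).
Hypothesis hp : balanced p.

Lemma dominatedD f g : dominated (p f) -> dominated (p g) -> dominated (p (f + g)).
Proof.
move=> [C fC] [D gD]; exists (2 * C + 2 * D) => v.
have := fC (ofR 2^-1 *: v); have := gD (ofR 2^-1 *: v).
by rewrite !(balRr hp) !(quadR hq) (balDl hp); lra.
Qed.

Lemma conjZ_le c f C : (forall v, 2 * p f v - q v <= C) ->
  forall v, 2 * p (c *: f) v - q v <= abs2 c * C.
Proof.
move=> fC v; have [->|c0] := eqVneq c 0.
  rewrite scale0r (bal0l hp) mulr0 /abs2 mul0r raddf0 mul0r.
  by have := quad_ge0 hq v; lra.
have := ler_wpM2l (abs2_ge0 c) (fC (c^-1 *: v)).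
by rewrite mulrBr -(quadZ hq) mulrCA -(balZZ hp) scalerKV.
Qed.

Lemma dominatedZ c f : dominated (p f) -> dominated (p (c *: f)).
Proof. by move=> [C fC]; exists (abs2 c * C); exact: conjZ_le. Qed.

(** Dual norms satisfy the parallelogram law: evaluate f + g at u and f - g at
    w, and regroup as f at u + w and g at u - w. *)
Lemma conjugate_quadratic : (forall f, dominated (p f)) ->
  quadratic (fun f => conjugate (p f)).
Proof.
move=> dom.
have le_conj c f : conjugate (p (c *: f)) <= abs2 c * conjugate (p f).
  by apply: conjugate_le; apply: conjZ_le => v; exact: conjugate_ub.
have conj0 : conjugate (p 0) = 0.
  apply/eqP; rewrite eq_le conjugate_ge0 ?andbT //; last exact: bal_real_linear.
  by apply: conjugate_le => v; rewrite bal0l //; have := quad_ge0 hq v; lra.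
split=> [|f|f g]; first exact: abs2_homogeneous.
- by apply: conjugate_ge0 => //; exact: bal_real_linear.
rewrite -lerBrDr; apply: conjugate_le => u.
rewrite lerBrDl -lerBrDr; apply: conjugate_le => w.
have := conjugate_ub (ofR 2^-1 *: (u + w)) (dom f).
have := conjugate_ub (ofR 2^-1 *: (u - w)) (dom g).
rewrite !(balRr hp) !(quadR hq).
rewrite !(balDl hp) !(balDr hp) (balNl hp) (balNr hp).
have := quad_par hq u w; lra.
Qed.

End Conjugate.

(** Polarization: 4 b u v = b (u + v) (u + v) - b (u - v) (u - v). *)
Lemma diag_polarization (V : lmodType F) (q : V -> R) (b : V -> V -> R) :
  quadratic q -> balanced b -> (forall u v, b u v = b v u) ->
  (forall v, `|b v v| <= q v) ->
  forall u v, 2 * b u v - q v <= q u.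
Proof.
move=> hq hb symb bq u v; have := bq (u + v); have := bq (u - v).
rewrite !ler_norml => /andP[+ _] /andP[_ +]; have := quad_par hq u v.
rewrite !(balDl hb) !(balDr hb) !(balNl hb) !(balNr hb) [b v u]symb; lra.
Qed.

(** A majorant q of b that is minimal below q0 is its own conjugate q' along b:
    otherwise (q + q') / 2 would be smaller, and it still majorises b since
    q' v >= 2 * |b v v| - q v.  Minimal majorants
    exist by Zorn's lemma, since the infimum of a chain of quadratic forms is a
    quadratic form. *)
Lemma selfconjugate_majorant (V : lmodType F) (q0 : V -> R) (b : V -> V -> R) :
  quadratic q0 -> balanced b -> (forall u v, b u v = b v u) ->
  (forall v, `|b v v| <= q0 v) ->
  exists q : V -> R, [/\ quadratic q, forall v, q v <= q0 v,
    forall v, `|b v v| <= q v & forall v, conjugate q (b v) = q v].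
Proof.
move=> hq0 hb symb bq0.
pose P (q : V -> R) :=
  [/\ quadratic q, forall v, q v <= q0 v & forall v, `|b v v| <= q v].
(* reversed order, so that maximal elements are minimal majorants *)
pose le (s t : {q | P q}) := `[< forall v, sval t v <= sval s v >].
have [| | |C leC|[q [hq qq0 bq]] qmin] := @Zorn {q | P q} le.
- by move=> s; apply/asboolP.
- move=> r s t /asboolP rs /asboolP st; apply/asboolP => v.
  exact: le_trans (st v) (rs v).
- move=> [s Ps] [t Pt] /asboolP st /asboolP ts; apply: eq_exist.
  by apply/funext => v; apply/eqP; rewrite eq_le st ts.
- have [C0|/set0P[c0 Cc0]] := eqVneq C set0; last first.
    pose qi v := inf [set sval s v | s in C].
    have lbC v : has_lbound [set sval s v | s in C].
      by exists 0 => _ [s _ <-]; case: (svalP s) => hs _ _; exact: quad_ge0.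
    have qi_le v s : C s -> qi v <= sval s v.
      by move=> Cs; apply: ge_inf => //; exists s.
    have le_qi v x : (forall s, C s -> x <= sval s v) -> x <= qi v.
      move=> xs; apply: lb_le_inf; first by exists (sval c0 v), c0.
      by move=> _ [s Cs <-]; exact: xs.
    have qi_Zle c v : abs2 c * qi v <= qi (c *: v).
      apply: (le_qi) => s Cs; case: (svalP s) => hs _ _; rewrite (quadZ hs).
      by apply: ler_wpM2l; [exact: abs2_ge0|exact: qi_le].
    have qi0 v : 0 <= qi v.
      by apply: (le_qi) => s _; case: (svalP s) => hs _ _; exact: quad_ge0.
    have qi_quad : quadratic qi.
      split=> // [|u v].
        have qi_0 : qi 0 = 0.
          apply/eqP; rewrite eq_le qi0 andbT; apply: le_trans (qi_le _ _ Cc0) _.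
          by case: (svalP c0) => hs _ _; rewrite (quad0 hs).
        have := @abs2_homogeneous _ _ V (fun v => - qi v).
        rewrite qi_0 oppr0 => /(_ erefl) h c v; apply: oppr_inj.
        by rewrite h -?mulrN // => c' v'; rewrite mulrN lerN2.
      have par_le s t : C s -> C t ->
          qi (u + v) + qi (u - v) <= 2 * (sval s u + sval t v).
        have aux r : C r -> sval r u <= sval s u -> sval r v <= sval t v ->
            qi (u + v) + qi (u - v) <= 2 * (sval s u + sval t v).
          move=> Cr ru rv; case: (svalP r) => hr _ _.
          have := qi_le (u + v) _ Cr; have := qi_le (u - v) _ Cr.
          have := quad_par hr u v; lra.
        move=> Cs Ct; case: (leC s t Cs Ct) => /asboolP st.
          exact: (aux t Ct (st u) (lexx _)).
        exact: (aux s Cs (lexx _) (st v)).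
      have : (qi (u + v) + qi (u - v)) / 2 - qi u <= qi v.
        apply: (le_qi) => t Ct.
        have : (qi (u + v) + qi (u - v)) / 2 - sval t v <= qi u.
          by apply: (le_qi) => s Cs; have := par_le s t Cs Ct; lra.
        lra.
      lra.
    have Pqi : P qi.
      split=> // [v|v]; last by apply: (le_qi) => s _; case: (svalP s).
      by apply: le_trans (qi_le v _ Cc0) _; case: (svalP c0).
    by exists (exist P qi Pqi) => s Cs; apply/asboolP => v; exact: qi_le.
  by exists (exist P q0 (And3 hq0 (fun v => lexx (q0 v)) bq0)) => s; rewrite C0.
have bconj u v : 2 * b u v - q v <= q u by exact: diag_polarization.
have domb u : dominated q (b u) by exists (q u) => v.
have hconj := conjugate_quadratic hq hb domb.
pose mid v := (q v + conjugate q (b v)) / 2.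
have conj_le v : conjugate q (b v) <= q v by exact: conjugate_le.
have Pmid : P mid.
  split=> [|v|v].
  - split=> [c v|v|u v]; rewrite /mid.
    + by rewrite (quadZ hq) (quadZ hconj); lra.
    + by have := quad_ge0 hq v; have := quad_ge0 hconj v; lra.
    + by have := quad_par hq u v; have := quad_par hconj u v; lra.
  - by apply: le_trans (qq0 v); rewrite /mid; have := conj_le v; lra.
  - have := conjugate_ub v (domb v); have := conjugate_ub (- v) (domb v).
    by rewrite (quadN hq) (balNr hb) ler_norml /mid => *; apply/andP; split; lra.
exists q; split=> // v.
have le_mid : le (exist P q (And3 hq qq0 bq)) (exist P mid Pmid).
  by apply/asboolP => w /=; rewrite /mid; have := conj_le w; lra.
have := congr1 (fun s => sval s v) (qmin _ le_mid).
by rewrite /= /mid; lra.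
Qed.

End QuadraticForms.

(** * Completeness, the Riesz theorem and uniform boundedness *)

Section Completeness.
Variables (R : realType) (k : RorC).
Local Notation F := (scal R k).
Local Notation conj := (@conjF R k).
Local Notation ofR := (@ofR R k).

Definition qcomplete (V : lmodType F) (q : V -> R) : Prop := forall u : nat -> V,
  (forall e, 0 < e -> exists N, forall m n, (N <= m)%N -> (N <= n)%N ->
     q (u m - u n) < e) ->
  exists l, forall e, 0 < e -> exists N, forall n, (N <= n)%N -> q (u n - l) < e.

(** The parabola t^2 c - t d is nonnegative, so its slope at 0 vanishes. *)
Lemma linear_le_quadratic (d c : R) :
  0 <= c -> (forall t, t * d <= t ^+ 2 * c) -> d = 0.
Proof.
move=> c0 h; have c1 : 0 < c + 1 by lra.
have := h (d / (c + 1)).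
have -> : d / (c + 1) * d = (d ^+ 2 * (c + 1)) / (c + 1) ^+ 2.
  by field; rewrite gt_eqF.
rewrite expr_div_n [leRHS]mulrAC ler_pM2r ?invr_gt0 ?exprn_gt0 // mulrDr mulr1.
rewrite -lerBrDl subrr => d2; apply/eqP.
by rewrite -sqrf_eq0 eq_le d2 sqr_ge0.
Qed.

Section QComplete.
Variables (V : lmodType F) (q : V -> R).
Hypothesis hq : quadratic q.

(** A sequence that maximises 2 phi - q is Cauchy by the parallelogram law, and
    its limit represents phi because its value cannot be improved in any
    direction. *)
Lemma riesz (phi : V -> R) (C M : R) : qcomplete q -> real_linear phi ->
  (forall v, 2 * phi v <= C + M * q v) ->
  exists z, forall v, polar q z v = phi v.
Proof.
move=> cq [phiD phiZ] phi_le.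
(* rescaling v turns the bound by M q into a bound by q itself *)
have dom : dominated q phi.
  pose M' := `|M| + 1; have M'0 : 0 < M' by rewrite /M' ltr_wpDl.
  exists (M' * C) => v; have := phi_le (ofR M'^-1 *: v).
  rewrite phiZ (quadR hq) => h.
  have MM : M * q v <= M' * q v.
    by apply: ler_wpM2r; [exact: quad_ge0|rewrite /M'; have := ler_norm M; lra].
  have h2 : 2 * (M'^-1 * phi v) <= C + M'^-1 ^+ 2 * (M' * q v).
    apply: le_trans h _; rewrite lerD2l mulrCA; apply: ler_wpM2l MM.
    exact: sqr_ge0.
  have := ler_wpM2l (ltW M'0) h2.
  have -> : M' * (2 * (M'^-1 * phi v)) = 2 * phi v by field; rewrite gt_eqF.
  have -> : M' * (C + M'^-1 ^+ 2 * (M' * q v)) = M' * C + q v.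
    by field; rewrite gt_eqF.
  lra.
set s := conjugate q phi.
have /choice[h hP] n : exists v, s - n.+1%:R^-1 < 2 * phi v - q v.
  by apply: conjugate_approx => //; rewrite invr_gt0.
have h_close m n : q (h m - h n) <= 2 * m.+1%:R^-1 + 2 * n.+1%:R^-1.
  have := conjugate_ub (ofR 2^-1 *: (h m + h n)) dom; rewrite -/s.
  rewrite phiZ (quadR hq) phiD; have := quad_par hq (h m) (h n).
  have := hP m; have := hP n.
  move: (m.+1%:R^-1) (n.+1%:R^-1) => a b; lra.
have inv_small (e : R) : 0 < e -> exists N, forall n, (N <= n)%N -> n.+1%:R^-1 < e.
  move=> e0; exists (Num.truncn e^-1) => n Nn.
  rewrite invf_plt ?posrE //; apply: lt_le_trans (truncnS_gt _) _.
  by rewrite ler_nat ltnS.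
have [|z hz] := cq h.
  move=> e e0; have [|N hN] := inv_small (e / 4); first lra.
  exists N => m n Nm Nn; apply: le_lt_trans (h_close m n) _.
  have := hN m Nm; have := hN n Nn.
  by move: (m.+1%:R^-1) (n.+1%:R^-1) => a b; lra.
exists z => v; apply/eqP; rewrite eq_sym -subr_eq0; apply/eqP.
apply: (@linear_le_quadratic _ (q v)); first exact: quad_ge0.
move=> t; rewrite -(ler_pM2l (ltr0Sn _ 1)); apply/ler_addgt0Pr => e e0.
have [|N1 hN1] := inv_small (e / 2); first lra.
have [|N2 hN2] := hz (e / 2); first lra.
pose n := maxn N1 N2.
have n1 := hN1 n (leq_maxl _ _); have n2 := hN2 n (leq_maxr _ _).
have := hP n; have := conjugate_ub (h n + ofR t *: v) dom; rewrite -/s.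
have hb := polar_balanced hq.
have := polar_le hq (h n - z) (ofR t *: v).
rewrite ler_norml => /andP[_].
rewrite (quadD q _ (ofR t *: v)) phiD phiZ !(balRr hb) (balBl hb) (quadR hq).
move: n1 n2; move: (n.+1%:R^-1) => a; lra.
Qed.

Lemma cauchy_schwarz u v : polar q u v ^+ 2 <= q u * q v.
Proof.
have hb := polar_balanced hq; have qv0 := quad_ge0 hq v.
have par a b : 0 <= a ^+ 2 * q u - 2 * (a * b * polar q u v) + b ^+ 2 * q v.
  have := quad_ge0 hq (ofR a *: u + ofR (- b) *: v).
  by rewrite quadD !(quadR hq) (balRl hb) (balRr hb); lra.
have [qv|qv] := eqVneq (q v) 0.
  have -> : polar q u v = 0.
    apply: (@linear_le_quadratic _ (q u)); first exact: quad_ge0.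
    move=> t; have := par t 1; rewrite qv.
    have := mulr_ge0 (sqr_ge0 t) (quad_ge0 hq u); lra.
  by rewrite expr0n mulr_ge0 //; exact: quad_ge0.
have := par (q v) (polar q u v).
have -> : q v ^+ 2 * q u - 2 * (q v * polar q u v * polar q u v) +
  polar q u v ^+ 2 * q v = q v * (q u * q v - polar q u v ^+ 2) by ring.
by rewrite pmulr_rge0 ?subr_ge0 // lt_neqAle eq_sym qv.
Qed.

Definition qnorm v := Num.sqrt (q v).

Lemma sqr_qnorm v : qnorm v ^+ 2 = q v.
Proof. by rewrite sqr_sqrtr //; exact: quad_ge0. Qed.

Lemma polar_le_qnorm u v : `|polar q u v| <= qnorm u * qnorm v.
Proof.
have n0 w : 0 <= qnorm w by exact: sqrtr_ge0.
rewrite -(ger0_norm (mulr_ge0 (n0 u) (n0 v))) -ler_sqr ?nnegrE //.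
by rewrite !real_normK ?num_real // [leRHS]exprMn !sqr_qnorm cauchy_schwarz.
Qed.

Lemma qnormD u v : qnorm (u + v) <= qnorm u + qnorm v.
Proof.
have n0 w : 0 <= qnorm w by exact: sqrtr_ge0.
rewrite -ler_sqr ?nnegrE ?addr_ge0 // sqr_qnorm quadD sqrrD !sqr_qnorm.
have := polar_le_qnorm u v; rewrite ler_norml => /andP[_]; lra.
Qed.

Lemma qnormR r v : qnorm (ofR r *: v) = `|r| * qnorm v.
Proof. by rewrite /qnorm (quadR hq) sqrtrM ?sqr_ge0 // sqrtr_sqr. Qed.

Lemma qnormN v : qnorm (- v) = qnorm v.
Proof. by rewrite /qnorm (quadN hq). Qed.

Lemma qnorm_lt v e : 0 < e -> (qnorm v < e) = (q v < e ^+ 2).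
Proof.
move=> e0; rewrite -sqr_qnorm ltr_sqr ?nnegrE ?sqrtr_ge0 //; exact: ltW.
Qed.

(** x is the limit of steps of length 3^-n along g n, with signs that make each
    step increase |<x, g n>|.  The steps after the n-th have total length at
    most 3^-n / 2 and can undo at most half of that increase. *)
Lemma gliding_hump (g : nat -> V) : qcomplete q ->
  (forall n, n%:R * 3 ^+ n < qnorm (g n)) ->
  exists x, forall n, n%:R / 2 <= `|polar q x (g n)|.
Proof.
move=> cq g_gt; have hb := polar_balanced hq.
have g_gt0 n : 0 < qnorm (g n).
  by apply: le_lt_trans (g_gt n); rewrite mulr_ge0 // exprn_ge0.
pose step n (x : V) := ofR ((if 0 <= polar q x (g n) then 1 else -1) *
  (3^-1 ^+ n / qnorm (g n))) *: g n.
pose x := fix x n := if n is m.+1 then x m + step m (x m) else 0.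
have step_norm n y : qnorm (step n y) = 3^-1 ^+ n.
  rewrite qnormR normrM (_ : `|if _ then _ else _| = 1); last first.
    by case: ifP => _; rewrite ?normrN normr1.
  rewrite mul1r ger0_norm ?divfK ?gt_eqF // divr_ge0 ?exprn_ge0 ?invr_ge0 //.
  exact: ltW.
have step_polar n : 3^-1 ^+ n * qnorm (g n) <= `|polar q (x n.+1) (g n)|.
  have e : 3^-1 ^+ n / qnorm (g n) * q (g n) = 3^-1 ^+ n * qnorm (g n).
    by rewrite -(sqr_qnorm (g n)) expr2 mulrA divfK // gt_eqF.
  rewrite /= (balDl hb) (balRl hb) (polarE hq) -mulrA e.
  have : 0 <= 3^-1 ^+ n * qnorm (g n) :> R.
    by rewrite mulr_ge0 ?exprn_ge0 ?invr_ge0 // ltW.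
  move: (3^-1 ^+ n * qnorm _) => a a0; case: ifP => [p0|/negbT].
    by rewrite mul1r ger0_norm ?addr_ge0 // lerDr.
  by rewrite -ltNge => p0; rewrite mulN1r ler0_norm; lra.
have tail n j : qnorm (x (n + j)%N - x n) <= 3^-1 ^+ n * (3 / 2) * (1 - 3^-1 ^+ j).
  elim: j => [|j IH].
    by rewrite addn0 subrr /qnorm (quad0 hq) sqrtr0 expr0 subrr mulr0.
  rewrite addnS /= addrAC; apply: le_trans (qnormD _ _) _.
  rewrite step_norm exprD exprSr; move: IH.
  move: (3^-1 ^+ n) (3^-1 ^+ j) => a b; lra.
have tail_le n m : (n <= m)%N -> qnorm (x m - x n) <= 3 / 2 * 3^-1 ^+ n.
  move=> nm; rewrite -(subnKC nm); apply: le_trans (tail _ _) _.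
  have : 0 <= 3^-1 ^+ n :> R by rewrite exprn_ge0 ?invr_ge0.
  have : 0 <= 3^-1 ^+ (m - n) :> R by rewrite exprn_ge0 ?invr_ge0.
  by move: (3^-1 ^+ n) (3^-1 ^+ (m - n)) => a b; nra.
have pow_small (e : R) : 0 < e -> exists N, 3^-1 ^+ N < e.
  move=> e0; exists (Num.truncn e^-1).+1; rewrite exprVn invf_plt ?posrE ?exprn_gt0 //.
  apply: lt_trans (truncnS_gt _) _; rewrite -natrX ltr_nat; exact: ltn_expl.
have [|l hl] := cq x.
  move=> e e0; have [|N hN] := pow_small (Num.sqrt e / 3).
    by rewrite divr_gt0 // sqrtr_gt0.
  exists N => m n Nm Nn; rewrite -(sqr_sqrtr (ltW e0)) -qnorm_lt ?sqrtr_gt0 //.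
  have -> : x m - x n = (x m - x N) + - (x n - x N) by rewrite opprB addrA subrK.
  apply: le_lt_trans (qnormD _ _) _; rewrite qnormN.
  have := tail_le _ _ Nm; have := tail_le _ _ Nn.
  by move: hN; move: (3^-1 ^+ N) => a; lra.
have l_close n : qnorm (x n - l) <= 3 / 2 * 3^-1 ^+ n.
  apply/ler_addgt0Pr => e e0; have [N hN] := hl _ (exprn_gt0 2 e0).
  have := hN (maxn N n) (leq_maxl _ _); rewrite -qnorm_lt // => le.
  have -> : x n - l = - (x (maxn N n) - x n) + (x (maxn N n) - l).
    by rewrite opprB addrA subrK.
  apply: le_trans (qnormD _ _) _; rewrite qnormN.
  by apply: lerD (ltW le); apply: tail_le; exact: leq_maxr.
exists l => n; have := step_polar n; have := polar_le_qnorm (x n.+1 - l) (g n).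
have := ler_wpM2r (ltW (g_gt0 n)) (l_close n.+1).
rewrite exprSr (balBl hb) => h1 h2 h3.
have : n%:R <= 3^-1 ^+ n * qnorm (g n).
  rewrite -ler_pdivrMl ?exprn_gt0 ?invr_gt0 // exprVn invrK mulrC; exact: ltW.
have := ler_normD (polar q (x n.+1) (g n) - polar q l (g n)) (polar q l (g n)).
rewrite subrK; move: h1 h2 h3.
have -> : 3 / 2 * (3^-1 ^+ n / 3) * qnorm (g n) = 3^-1 ^+ n * qnorm (g n) / 2.
  by field.
by move: (3^-1 ^+ n * qnorm (g n)) => a; lra.
Qed.

(** Weakly bounded families are bounded: otherwise gliding_hump gives a vector
    at which some subfamily is unbounded. *)
Lemma uniform_boundedness (I : Type) (g : I -> V) : qcomplete q ->
  (forall f, exists C, forall i, `|polar q f (g i)| <= C) ->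
  exists C, forall i, q (g i) <= C.
Proof.
move=> cq weak; apply: contrapT => /forallNP unb.
have /choice[i iP] n : exists i, n%:R * 3 ^+ n < qnorm (g i).
  have := unb ((n%:R * 3 ^+ n) ^+ 2) => /existsNP[i /negP]; rewrite -ltNge => lt.
  exists i; rewrite -ltr_sqr ?nnegrE ?sqr_qnorm ?sqrtr_ge0 //.
  by rewrite mulr_ge0 // exprn_ge0.
have [x xP] := gliding_hump cq iP; have [C CP] := weak x.
have := truncnS_gt (2 * C); set N := (Num.truncn _).+1.
by have := xP N; have := CP (i N); lra.
Qed.

End QComplete.

Section InnerProducts.
Variables (V : lmodType F) (ip : {dot V for conj}).

Definition sqnorm (v : V) : R := reF (ip v v).

Lemma sqnorm_quadratic : quadratic sqnorm.
Proof.
apply: (quadratic_diag (hermitian_balanced ip)) => v.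
have [->|v0] := eqVneq v 0; first by rewrite linear0l raddf0.
exact/reF_ge0/ltW/(neq0_dnorm_gt0 (s := ip)).
Qed.

Lemma sqnorm_polar u v : polar sqnorm u v = reF (ip u v).
Proof. exact: (polar_diag _ _ (hermitian_balanced ip) (reF_hermC ip)). Qed.

Lemma sqnorm_eq0 v : sqnorm v = 0 -> v = 0.
Proof.
move=> v0; apply/eqP; apply: contraT => /(neq0_dnorm_gt0 (s := ip)) /reF_gt0.
by rewrite -/(sqnorm v) v0 ltxx.
Qed.

(** Rewriting completeness without square roots or filters. *)
Lemma ip_completeP : ip_complete ip <-> qcomplete sqnorm.
Proof.
split=> [cip u hu|cq u hu].
  have [|l ul] := cip u.
    move=> e e0; have [N hN] := hu _ (exprn_gt0 2 e0).
    exists ([set n | (N <= n)%N], [set n | (N <= n)%N]) => /=.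
      by split; exists N.
    by move=> [m n] /= [Nm Nn]; rewrite (qnorm_lt sqnorm_quadratic) // hN.
  exists l => e e0; move/cvgrPdist_lt: ul => /(_ (Num.sqrt e)).
  rewrite sqrtr_gt0 => /(_ e0) [N _ hN]; exists N => n Nn.
  have := hN n Nn; rewrite /= sub0r normrN ger0_norm ?sqrtr_ge0 //.
  by rewrite (qnorm_lt sqnorm_quadratic) ?sqrtr_gt0 // sqr_sqrtr // ltW.
have [|l ul] := cq u.
  move=> e e0; have se0 : 0 < Num.sqrt e by rewrite sqrtr_gt0.
  have /= [[P Q] /= [[N1 _ hP] [N2 _ hQ]] hPQ] := hu _ se0.
  exists (maxn N1 N2) => m n; rewrite !geq_max => /andP[m1 _] /andP[_ n2].
  rewrite -(sqr_sqrtr (ltW e0)) -(qnorm_lt sqnorm_quadratic) //.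
  by apply: (hPQ (m, n)); split; [exact: hP|exact: hQ].
exists l; apply/cvgrPdist_lt => e e0.
have [N hN] := ul _ (exprn_gt0 2 e0); exists N => // n /= Nn.
rewrite sub0r normrN ger0_norm ?sqrtr_ge0 //.
by rewrite (qnorm_lt sqnorm_quadratic) // hN.
Qed.

End InnerProducts.
End Completeness.

(** * Completion of a majorised form to a Krein space *)

Section KreinCompletion.
Variables (R : realType) (k : RorC).
Local Notation F := (scal R k).
Local Notation conj := (@conjF R k).
Local Notation ofR := (@ofR R k).

(** A dual space is complete: a Cauchy sequence of functionals converges
    pointwise, and the bounds pass to the pointwise limit. *)
Lemma conjugate_qcomplete (E V : lmodType F) (p : E -> V -> R) (q : V -> R) :
  quadratic q -> balanced p -> (forall f, dominated q (p f)) ->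
  (forall phi, real_linear phi -> dominated q phi ->
     exists f, forall v, p f v = phi v) ->
  qcomplete (fun f => conjugate q (p f)).
Proof.
move=> hq hp dom rep; pose N f := conjugate q (p f); rewrite -[X in qcomplete X]/N.
move=> u hu.
have hN : quadratic N by exact: conjugate_quadratic.
have cv v : cvg (p (u n) v @[n --> \oo]).
  apply: cauchy_cvg; apply: cauchy_exP => e e0.
  have qv1 : 0 < q v + 1 by rewrite ltr_wpDl //; exact: quad_ge0.
  (* the weight for which conjugate_bound makes both of its terms small *)
  pose t := (q v + 1) / e; have t0 : 0 < t by rewrite divr_gt0.
  have tq : t^-1 * q v < e.
    by rewrite /t invf_div mulrAC ltr_pdivrMr // ltr_pM2l // ltrDl.
  have p_lt f : N f < e / t -> p f v < e.
    rewrite ltr_pdivlMr // mulrC => tN.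
    have := conjugate_bound hq v (bal_real_linear hp f) (dom f) t0.
    by move: tN; rewrite -/(N f); lra.
  have [|M hM] := hu (e / t); first by rewrite divr_gt0.
  exists (p (u M) v); exists M => // n /= Mn.
  rewrite /ball /= -(balBl hp) ltr_norml ltrNl -(balNl hp) opprB.
  by rewrite !p_lt ?hM.
pose phi v := lim (p (u n) v @[n --> \oo]).
have phi_cvg v : p (u n) v @[n --> \oo] --> phi v by exact: cv.
have phi_lin : real_linear phi.
  split=> [v w|r v]; apply: cvg_lim => //.
    rewrite (_ : (fun n => _) = (fun n => p (u n) v + p (u n) w)).
      exact: cvgD.
    by apply/funext => n; exact: balDr.
  rewrite (_ : (fun n => _) = (fun n => r * p (u n) v)).
    exact: cvgMr.
  by apply/funext => n; exact: balRr.
have [|M hM] := hu 1; first exact: ltr01.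
have [|f fE] := rep phi phi_lin.
  exists (2 * N (u M) + 2) => v.
  suff : phi v <= (2 * N (u M) + 2 + q v) / 2 by lra.
  apply: limr_le => //; exists M => // n /= Mn.
  have := quad_par hN (u n - u M) (u M); rewrite subrK.
  have := quad_ge0 hN (u n - u M - u M); have := hM n M Mn (leqnn M).
  have := conjugate_ub v (dom (u n)); rewrite -/(N (u n)); lra.
exists f => e e0; have [|M' hM'] := hu (e / 2); first lra.
exists M' => n Mn; apply: le_lt_trans (_ : _ <= e / 2) _; last lra.
apply: conjugate_le => v; rewrite (balBl hp) fE.
suff : p (u n) v - (q v + e / 2) / 2 <= phi v by lra.
apply: limr_ge => //; exists M' => // m /= Mm.
have := conjugate_ub v (dom (u n - u m)); rewrite -/(N (u n - u m)).
by rewrite (balBl hp); have := hM' n m Mn Mm; lra.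
Qed.

(** Here p is the real part of the evaluation of elements of Y as
    conjugate-linear functionals on V, and the last hypothesis says that all
    functionals bounded by q0 arise so.  With a self-conjugate majorant q, the
    functionals bounded by q form a Hilbert space that contains ell v,
    representing the polar form q(v, .), and kap v, representing b(v, .).  Self-conjugacy is the equality
    |kap v|^2 = q v = |ell v|^2.  Hence J, defined by (J f)(w) = <f, kap w>,
    exchanges ell v with kap v; the ell v being dense, J is an isometric
    involution. *)
Lemma krein_completion (Y V : lmodType F) (p : Y -> V -> R)
    (b : V -> V -> R) (q0 : V -> R) :
  balanced p -> (forall f, (forall v, p f v = 0) -> f = 0) ->
  balanced b -> (forall u v, b u v = b v u) ->
  quadratic q0 -> (forall v, `|b v v| <= q0 v) ->
  (forall phi, real_linear phi -> dominated q0 phi ->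
     exists f, forall v, p f v = phi v) ->
  exists (D : submodClosed Y) (S : krein_structure (subsp D))
    (kap : V -> subsp D),
    [/\ forall v w, p (val (kap v)) w = b v w,
        forall f v, reF (kform S f (kap v)) = p (val f) v
      & forall f e, 0 < e -> exists v, sqnorm (kdot S) (f - kap v) < e].
Proof.
move=> hp p_inj hb symb hq0 bq0 rep.
have [q [hq qq0 bq qE]] := selfconjugate_majorant hq0 hb symb bq0.
pose D := Lin [set f | dominated q (p f)].
have DE f : f \in D <-> dominated q (p f).
  split=> [|fq]; last exact: mem_Lin.
  apply: (@Lin_ind _ _ _ (fun f => dominated q (p f))) => // [|c u v uq vq].
    exists 0 => v; rewrite (bal0l hp); have := quad_ge0 hq v; lra.
  by apply: dominatedD => //; exact: dominatedZ.
pose E := subsp D.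
pose P (f : E) := p (val f).
have domP f : dominated q (P f) by apply/DE; exact: valP.
have hP : balanced P.
  split=> [f g v|f u v|r f v|c f v]; rewrite /P ?raddfD ?linearZ /=.
  - exact: balDl.
  - exact: balDr.
  - exact: balRl.
  - exact: balC.
have E_inj f g : (forall v, P f v = P g v) -> f = g.
  move=> fg; apply/eqP; rewrite -subr_eq0; apply/eqP/val_inj/p_inj => v.
  by rewrite -/(P (f - g) v) (balBl hP) fg subrr.
have repE phi : real_linear phi -> dominated q phi ->
    exists f : E, forall v, P f v = phi v.
  move=> lin [C phiC]; have [|f fE] := rep phi lin.
    by exists C => v; have := phiC v; have := qq0 v; lra.
  have fD : f \in D.
    by apply/DE; exists C => v; rewrite fE.
  by exists (exist _ f fD).
pose N f := conjugate q (P f).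
have hN : quadratic N by exact: conjugate_quadratic.
have hip := polar_balanced hN.
have symip f g : polar N f g = polar N g f by exact: polarC.
have hr := polar_balanced hq.
have /choice[ell ellE] v : exists f, forall w, P f w = polar q v w.
  apply: (repE (polar q v)); first exact: bal_real_linear.
  exists (q v) => w; have := polar_le hq v w.
  by rewrite ler_norml => /andP[_]; lra.
have /choice[kap kapE] v : exists f, forall w, P f w = b v w.
  apply: (repE (b v)); first exact: bal_real_linear.
  by exists (q v); exact: diag_polarization.
have N_ell_add f v : N (f + ell v) = N f + 2 * P f v + q v.
  apply/eqP; rewrite eq_le; apply/andP; split.
    apply: conjugate_le => w; have := conjugate_ub (w - v) (domP f).
    rewrite (balBr hP) (balDl hP) ellE -/(N f) [q (w - v)]quadD.
    rewrite (quadN hq) (balNr hr) [polar q w v]polarC; lra.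
  rewrite -lerBrDr -lerBrDr; apply: conjugate_le => u.
  have := conjugate_ub (u + v) (domP (f + ell v)); rewrite -/(N _).
  rewrite (balDr hP) !(balDl hP) !ellE [q (u + v)]quadD [polar q u v]polarC.
  by rewrite (polarE hq); lra.
have N_ell v : N (ell v) = q v.
  by rewrite -[ell v]add0r N_ell_add (quad0 hN) (bal0l hP) mulr0 !add0r.
have ip_ell f v : polar N f (ell v) = P f v.
  by rewrite /polar N_ell_add N_ell; lra.
have N_kap v : N (kap v) = q v.
  by rewrite /N (_ : P (kap v) = b v) ?qE //; apply/funext.
have kapD v w : kap (v + w) = kap v + kap w.
  by apply: (E_inj) => u; rewrite (balDl hP) !kapE (balDl hb).
have ip_kap v w : polar N (kap v) (kap w) = polar q v w.
  by rewrite /polar -kapD !N_kap.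
have /choice[J JE] f : exists g, forall w, P g w = polar N f (kap w).
  apply: (repE (fun w => polar N f (kap w))).
    split=> [v w|r v]; first by rewrite kapD (balDr hip).
    rewrite (_ : kap (ofR r *: v) = ofR r *: kap v) ?(balRr hip) //.
    by apply: (E_inj) => u; rewrite (balRl hP) !kapE (balRl hb).
  exists (N f) => w; have := polar_le hN f (kap w); rewrite N_kap.
  by rewrite ler_norml => /andP[_]; lra.
have N_J_le f : N (J f) <= N f.
  apply: conjugate_le => w; rewrite JE; have := polar_le hN f (kap w).
  by rewrite N_kap ler_norml => /andP[_]; lra.
have J_lin : linear J.
  move=> c f g; apply: (E_inj) => w.
  rewrite JE (balDl hip) (balDl hP) JE (balC hip) (balC hP) JE.
  congr (polar N f _ + _); apply: (E_inj) => u.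
  by rewrite (balC hP) !kapE (balC hb).
have J_ell v : J (ell v) = kap v.
  by apply: (E_inj) => w; rewrite JE symip ip_ell !kapE symb.
have J_kap v : J (kap v) = ell v.
  by apply: (E_inj) => w; rewrite JE ip_kap ellE.
(* nearly optimal vectors v in the supremum N f give ell v close to f *)
have ell_dense f e : 0 < e -> exists v, N (f - ell v) < e.
  move=> e0; have [v hv] := conjugate_approx e0 (domP f); exists v.
  rewrite quadD (quadN hN) N_ell (balNr hip) ip_ell.
  by move: hv; rewrite -/(N f); lra.
pose Jl := linear_of J_lin.
have JB f g : J (f - g) = J f - J g by exact: (linearB Jl).
have JD f g : J (f + g) = J f + J g by exact: (linearD Jl).
have JZ c f : J (c *: f) = c *: J f by exact: (scalable_linear J_lin).
have N_small f : (forall e, 0 < e -> N f <= e) -> f = 0.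
  move=> f_small; have Nf : N f = 0.
    apply/eqP; rewrite eq_le quad_ge0 // andbT.
    by apply/ler_addgt0Pr => e /f_small; rewrite add0r.
  apply: (E_inj) => v; rewrite (bal0l hP).
  apply: (@linear_le_quadratic _ _ (q v)); first exact: quad_ge0.
  move=> t; have := conjugate_ub (ofR t *: v) (domP f).
  rewrite -/(N f) Nf (balRr hP) (quadR hq).
  have := sqr_ge0 t; have := quad_ge0 hq v; nra.
(* J \o J and the identity agree on the vectors ell v and are continuous *)
have JK f : J (J f) = f.
  apply/eqP; rewrite -subr_eq0; apply/eqP/N_small => e e0.
  have [|v hv] := ell_dense f (e / 4); first lra.
  have -> : J (J f) - f = J (J (f - ell v)) - (f - ell v).
    by rewrite !JB J_ell J_kap opprB addrA subrK.
  have := quad_par hN (J (J (f - ell v))) (f - ell v).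
  have := quad_ge0 hN (J (J (f - ell v)) + (f - ell v)).
  have := N_J_le (J (f - ell v)); have := N_J_le (f - ell v); lra.
have N_J f : N (J f) = N f.
  by apply/eqP; rewrite eq_le N_J_le -{1}[f]JK N_J_le.
have ip_J f g : polar N (J f) (J g) = polar N f g.
  by rewrite /polar -JD !N_J.
have J_sym f g : polar N (J f) g = polar N f (J g).
  by rewrite -{1}[g]JK ip_J.
have [dotE dotEP] : exists d : {dot E for conj}, forall f g, reF (d f g) = polar N f g.
  apply: dot_form => // f f0; rewrite (polarE hN) lt_neqAle quad_ge0 // andbT.
  apply: contra f0; rewrite eq_sym => /eqP Nf; apply/eqP/N_small => e /ltW.
  by rewrite Nf.
have hform : balanced (fun f g => polar N (J f) g).
  split=> [f g h|f g h|r f g|c f g].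
  - by rewrite JD (balDl hip).
  - exact: balDr.
  - by rewrite JZ (balRl hip).
  - by rewrite JZ (balC hip).
have [form formE] : exists d : {hermitian_sym E for conj},
    forall f g, reF (d f g) = polar N (J f) g.
  by apply: hermitian_form => // f g; rewrite J_sym symip.
have NE f : sqnorm dotE f = N f by rewrite /sqnorm dotEP (polarE hN).
have dotJ f g : dotE f g = form (J f) g.
  apply: reF_ext => c; rewrite -linearZl_LR dotEP.
  by rewrite -linearZl_LR /= -JZ formE JK.
have cplt : ip_complete dotE.
  apply/ip_completeP; rewrite (_ : sqnorm dotE = N); last exact/funext.
  exact: (conjugate_qcomplete hq hP domP repE).
exists D, (KreinStructure (ksym := Jl) JK dotJ cplt), kap; split=> //.
- by move=> f v; rewrite formE -J_ell ip_J ip_ell.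
- move=> f e e0; have [v hv] := ell_dense (J f) e e0; exists v.
  by rewrite NE -N_J JB -J_ell JK.
Qed.

End KreinCompletion.

(** * The reproducing kernel Krein space of a majorised kernel *)

(** Maps out of a space of formal sums, such as v |-> K v, are obtained as
    projections from the span of the triples (generator, image, image), which
    makes their linearity and well-definedness immediate. *)
Section Triples.
Variables (F : fieldType) (E Y : lmodType F) (A : set (E * Y * Y)%type).

Definition triple1 (v : subsp (Lin A)) : E := (val v).1.1.
Definition triple2 (v : subsp (Lin A)) : Y := (val v).1.2.
Definition triple3 (v : subsp (Lin A)) : Y := (val v).2.

Lemma triple1_linear : linear triple1. Proof. by []. Qed.
Lemma triple2_linear : linear triple2. Proof. by []. Qed.
Lemma triple3_linear : linear triple3. Proof. by []. Qed.

End Triples.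

Section Bounded.
Variables (R : realType) (k : RorC).
Local Notation F := (scal R k).
Local Notation conj := (@conjF R k).

Lemma bounded_linearP (V W : lmodType F) (ipV : {dot V for conj})
    (ipW : {dot W for conj}) (T : V -> W) :
  bounded_linear ipV ipW T <->
  linear T /\ exists C, forall v, sqnorm ipW (T v) <= C * sqnorm ipV v.
Proof.
have q0 (U : lmodType F) (ip : {dot U for conj}) v : 0 <= sqnorm ip v.
  exact: (quad_ge0 (sqnorm_quadratic ip)).
split=> -[linT [C TC]]; split=> //.
  exists (C ^+ 2) => v; rewrite -(sqr_sqrtr (q0 _ ipW _)) -[sqnorm ipV v]sqr_sqrtr //.
  by rewrite -exprMn ler_sqr ?nnegrE ?(le_trans _ (TC v)) ?sqrtr_ge0 // TC.
exists (Num.sqrt `|C|) => v; rewrite /ipnorm -sqrtrM // ler_sqrt.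
  by apply: le_trans (TC v) _; apply: ler_wpM2r; [exact: q0|exact: ler_norm].
by apply: mulr_ge0; [exact: normr_ge0|exact: q0].
Qed.

End Bounded.

Section ReproducingKernel.
Variables (R : realType) (k : RorC) (G : star_semigroupoid) (X : Type).
Variables (A : left_action G X) (H : X -> hilbert R k).
Local Notation F := (scal R k).
Local Notation conj := (@conjF R k).
Local Notation ofR := (@ofR R k).
Local Notation fiber := (fiber A).

Section Fiber.
Variables (K L : kernel_family H) (s : symb G).
Local Notation sec := (sections A H s).
Hypotheses (linK : forall x y, linear (@K x y)) (linL : forall x y, linear (@L x y)).

(** The functional f |-> <h, f x> stands for the formal generator (x, h); unlike
    a section supported at x it needs no case distinction on points. *)
Definition evaluation (x : fiber s) (h : H (sval x)) : sec -> F^o :=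
  fun f => hdot (H (sval x)) h (f x).

Definition atoms : set ((sec -> F^o) * sec * sec)%type :=
  [set v | exists (x : fiber s) (h : H (sval x)),
     v = (evaluation h, kernel_section K h, kernel_section L h)].

Local Notation V := (subsp (Lin atoms)).

Lemma atom_mem (x : fiber s) (h : H (sval x)) :
  (evaluation h, kernel_section K h, kernel_section L h) \in Lin atoms.
Proof. by apply: mem_Lin; exists x, h. Qed.

Definition atom (x : fiber s) (h : H (sval x)) : V :=
  exist (fun v => v \in Lin atoms) _ (atom_mem h).

Lemma atom_linear (x : fiber s) : linear (@atom x).
Proof.
move=> c h h'; apply: val_inj => /=.
rewrite [RHS]/(_ *: _ + _) /=; congr (_, _, _); apply: functional_extensionality_dep => y.
- by rewrite /evaluation linearDl linearZl_LR.
- exact: linK.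
- exact: linL.
Qed.

(** The real part of v(f), the value of the section f on the formal sum v. *)
Definition pairing (f : sec) (v : V) : R := reF (triple1 v f).

Lemma pairing_atom f (x : fiber s) (h : H (sval x)) :
  pairing f (atom h) = reF (hdot (H (sval x)) (f x) h).
Proof. exact: reF_hermC. Qed.

Lemma pairing_balanced : balanced pairing.
Proof.
pose ev (v : V) (f : sec) : F := triple1 v f.
have ev_lin c u v f : ev (c *: u + v) f = c * ev u f + ev v f.
  by rewrite /ev triple1_linear fct_linearP.
have ev0 f : ev 0 f = 0.
  have := ev_lin (-1) 0 0 f; rewrite scaleN1r mulN1r.
  by rewrite addNr (addNr (ev 0 f)).
have evD (v : V) (f g : sec) : ev v (f + g) = ev v f + ev v g.
  elim/subsp_Lin_ind: v => [|c u v Hu Hv|v].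
  - by rewrite !ev0 addr0.
  - by rewrite !ev_lin Hu Hv mulrDr addrACA.
  - by rewrite /ev /triple1 => -[x [h ->]] /=; rewrite /evaluation linearDr.
have evZ (v : V) (a : F) (f : sec) : ev v (a *: f) = conj a * ev v f.
  elim/subsp_Lin_ind: v => [|c u v Hu Hv|v].
  - by rewrite !ev0 mulr0.
  - by rewrite !ev_lin Hu Hv mulrDr [c * (_ * _)]mulrCA.
  - by rewrite /ev /triple1 => -[x [h ->]] /=; rewrite /evaluation linearZr_LR.
split=> [f g v|f u v|r f v|c f v]; rewrite /pairing -!/(ev _ _).
- by rewrite evD raddfD.
- by rewrite -[u]scale1r ev_lin mul1r scale1r raddfD.
- by rewrite evZ conj_ofR reF_ofRM.
- by rewrite evZ -[_ *: v]addr0 ev_lin ev0 addr0.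
Qed.

(** Real linearity is enough since scalar multiples of atoms are atoms. *)
Lemma real_linear_atom_ext (phi psi : V -> R) :
  real_linear phi -> real_linear psi ->
  (forall (x : fiber s) (h : H (sval x)), phi (atom h) = psi (atom h)) ->
  forall v, phi v = psi v.
Proof.
move=> [phiD phiZ] [psiD psiZ] phipsi v.
suff vE c : phi (c *: v) = psi (c *: v) by have := vE 1; rewrite scale1r.
elim/subsp_Lin_ind: v c => [c|a u v Hu Hv c|v [x [h vE]] c].
- by rewrite scaler0 -(scale0r 0) -(rmorph0 ofR) phiZ psiZ !mul0r.
- by rewrite scalerDr scalerA phiD psiD Hu Hv.
- rewrite (_ : v = atom h); last exact: val_inj.
  by rewrite -(scalable_linear (@atom_linear x)) phipsi.
Qed.

Lemma atom_sum (v : V) : exists (n : nat) (z : 'I_n -> {x : fiber s & H (sval x)}),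
  v = \sum_i atom (projT2 (z i)).
Proof.
have /asboolP[n [c [w [wA vE]]]] := valP v.
have /choice[z wE] i : exists z : {x : fiber s & H (sval x)},
    w i = val (atom (projT2 z)).
  by have [x [h ->]] := wA i; exists (existT _ x h).
exists n, (fun i => existT _ (projT1 (z i)) (c i *: projT2 (z i))).
apply: val_inj; rewrite vE raddf_sum; apply: eq_bigr => i _; rewrite wE.
exact: (congr1 val (esym (scalable_linear (@atom_linear (projT1 (z i)))
  (c i) (projT2 (z i))))).
Qed.

Section Operator.
Variables (M : kernel_family H) (T : V -> sec).
Hypotheses (linT : linear T)
  (T_atom : forall (x : fiber s) (h : H (sval x)), T (atom h) = kernel_section M h).

Lemma operator_balanced : balanced (fun v w => pairing (T v) w).
Proof.
have TD u v : T (u + v) = T u + T v by have := linT 1 u v; rewrite !scale1r.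
have TZ := scalable_linear linT.
have hp := pairing_balanced.
split=> [u v w|u v w|r u v|c u v].
- by rewrite TD (balDl hp).
- exact: balDr.
- by rewrite TZ (balRl hp).
- by rewrite TZ (balC hp).
Qed.

Lemma operator_atom (x y : fiber s) (h : H (sval x)) (g : H (sval y)) :
  pairing (T (atom h)) (atom g) =
  reF (hdot (H (sval y)) (M (sval y) h) g).
Proof. by rewrite pairing_atom T_atom. Qed.

Lemma operator_sym : partially_hermitian A M ->
  forall u v, pairing (T u) v = pairing (T v) u.
Proof.
move=> [_ hM] u; have hb := operator_balanced.
apply: real_linear_atom_ext.
- exact: (bal_real_linear pairing_balanced).
- by split=> [v w|r v]; [exact: (balDl hb)|exact: (balRl hb)].
move=> y g; have : forall v, pairing (T v) (atom g) = pairing (T (atom g)) v.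
  apply: real_linear_atom_ext.
  - by split=> [v w|r v]; [exact: (balDl hb)|exact: (balRl hb)].
  - exact: (bal_real_linear pairing_balanced).
  by move=> x h; rewrite !operator_atom hM reF_hermC.
exact.
Qed.

Lemma operator_ge0 : partially_positive A M -> forall v, 0 <= pairing (T v) v.
Proof.
move=> [_ posM] v; have hb := operator_balanced.
have [n [z ->]] := atom_sum v.
have suml (u : 'I_n -> V) w : pairing (T (\sum_i u i)) w = \sum_i pairing (T (u i)) w.
  by apply: (big_morph (fun u => pairing (T u) w)) => [a b|];
    [exact: (balDl hb)|exact: (bal0l hb)].
have sumr (u : 'I_n -> V) f : pairing f (\sum_i u i) = \sum_i pairing f (u i).
  by apply: (big_morph (pairing f)) => [a b|];
    [exact: (balDr pairing_balanced)|exact: (bal0r pairing_balanced)].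
have /reF_ge0 := posM s n (fun i => projT1 (z i)) (fun i => projT2 (z i)).
rewrite raddf_sum suml /=; congr (0 <= _); apply: eq_bigr => i _.
rewrite raddf_sum sumr /=; apply: eq_bigr => j _.
by rewrite operator_atom.
Qed.

End Operator.

Hypotheses (hK : partially_hermitian A K) (hL : partially_positive A L)
  (hKL : kernel_le A K L).

Local Notation kv := (@triple2 F _ _ atoms).
Local Notation lv := (@triple3 F _ _ atoms).

Let kv_atom (x : fiber s) (h : H (sval x)) : kv (atom h) = kernel_section K h.
Proof. by []. Qed.
Let lv_atom (x : fiber s) (h : H (sval x)) : lv (atom h) = kernel_section L h.
Proof. by []. Qed.

Lemma pairing_eq0 f : (forall v, pairing f v = 0) -> f = 0.
Proof.
move=> f0; apply: functional_extensionality_dep => x.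
apply: (sqnorm_eq0 (ip := hdot (H (sval x)))).
by have := f0 (atom (f x)); rewrite pairing_atom.
Qed.

(** The quadratic form of 2L - K, which is above both K and -K as L >= 0 and L >= K. *)
Let q0 v := 2 * pairing (lv v) v - pairing (kv v) v.

(** The value at x of the representing section is the Riesz representer in H_x of
    h |-> phi (atom h); boundedness of K x x and L x x makes this functional
    bounded. *)
Lemma pairing_represent (phi : V -> R) : real_linear phi -> dominated q0 phi ->
  exists f, forall v, pairing f v = phi v.
Proof.
move=> lin_phi [C phiC].
have hl := operator_balanced (@triple3_linear _ _ _ atoms).
have fP (x : fiber s) : exists z, forall h,
    reF (hdot (H (sval x)) z h) = phi (atom h).
  have [_ [CK hCK]] := (bounded_linearP _ _ _).1 (hK.1 (sval x) (sval x)).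
  have [_ [CL hCL]] := (bounded_linearP _ _ _).1 (hL.1.1 (sval x) (sval x)).
  have hq := sqnorm_quadratic (hdot (H (sval x))).
  have [|||z zE] := @riesz _ _ _ _ hq (fun h => phi (atom h)) C
      (1 + CL + (1 + CK) / 2).
  - by apply/ip_completeP; exact: hcomplete.
  - case: lin_phi => phiD phiZ; split=> [h h'|r h].
      by rewrite -phiD -[h]scale1r atom_linear !scale1r.
    by rewrite -phiZ (scalable_linear (@atom_linear x)).
  - move=> h; have := phiC (atom h); rewrite /q0 !pairing_atom.
    rewrite lv_atom kv_atom /kernel_section -!sqnorm_polar.
    have := polar_le hq (L (sval x) h) h; have := polar_le hq (K (sval x) h) h.
    rewrite !ler_norml => /andP[+ _] /andP[_ +].
    have := hCK h; have := hCL h; lra.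
  by exists z => h; rewrite -sqnorm_polar zE.
exists (fun x => sval (cid (fP x))); apply: real_linear_atom_ext => // [|x h].
  exact: (bal_real_linear pairing_balanced).
by rewrite pairing_atom (svalP (cid (fP x))).
Qed.

(** krein_completion for the form of K.  The element kap v is the section
    K v, so that [f, kap v] = f(v) is the reproducing property at atoms. *)
Lemma rk_krein_exists : exists RK : rk_krein A K s,
  forall (f : krein_of_rk RK) (e : R), 0 < e ->
  exists2 g, g \in Lin [set v | exists (x : fiber s) (h : H (sval x)),
                                v = rk_section RK h] &
    sqnorm (kdot (krein_of_rk RK)) (f - g) < e.
Proof.
have lin2 := @triple2_linear _ _ _ atoms; have lin3 := @triple3_linear _ _ _ atoms.
have hk := operator_balanced lin2; have hl := operator_balanced lin3.
have linlk : linear (fun v => lv v - kv v).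
  move=> c u v; rewrite lin2 lin3 scalerBr opprD addrACA; congr (_ + _).
have lk_ge0 v : pairing (kv v) v <= pairing (lv v) v.
  rewrite -subr_ge0 -(balBl pairing_balanced).
  exact: (operator_ge0 linlk (fun _ _ => erefl) hKL).
have l_ge0 v : 0 <= pairing (lv v) v.
  exact: (operator_ge0 lin3 lv_atom hL).
have hq0B : balanced (fun u v => 2 * pairing (lv u) v - pairing (kv u) v).
  split=> [u v w|u v w|r u v|c u v].
  - by rewrite (balDl hk) (balDl hl); ring.
  - by rewrite !(balDr pairing_balanced); ring.
  - by rewrite (balRl hk) (balRl hl); ring.
  - by rewrite (balC hk) (balC hl).
have hq0 : quadratic q0.
  by apply: (quadratic_diag hq0B) => v; have := lk_ge0 v; have := l_ge0 v; lra.
have bq0 v : `|pairing (kv v) v| <= q0 v.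
  have := lk_ge0 v; have := l_ge0 v; rewrite /q0 ler_norml => *.
  by apply/andP; split; lra.
have symk := operator_sym lin2 kv_atom hK.
have [D [S [kap [kapE kform_kap kap_dense]]]] := krein_completion
  pairing_balanced pairing_eq0 hk symk hq0 bq0 pairing_represent.
have val_kap v : val (kap v) = kv v.
  apply/eqP; rewrite -subr_eq0; apply/eqP/pairing_eq0 => w.
  by rewrite (balBl pairing_balanced) kapE subrr.
have memD (x : fiber s) (h : H (sval x)) : kernel_section K h \in D.
  by rewrite -kv_atom -val_kap; exact: valP.
have kap_atom (x : fiber s) (h : H (sval x)) :
    kap (atom h) = exist _ (kernel_section K h) (memD x h).
  by apply: val_inj; rewrite val_kap.
have repro (f : subsp D) (x : fiber s) (h : H (sval x)) :
    hdot (H (sval x)) (val f x) h = kform S f (exist _ (kernel_section K h) (memD x h)).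
  rewrite -kap_atom; apply: reF_ext => c; rewrite -!linearZl_LR kform_kap.
  by rewrite pairing_atom.
exists (RKKrein repro) => f e e0 /=; have [v hv] := kap_dense f e e0.
have kap_lin : linear kap.
  by move=> c u w; apply: val_inj; rewrite val_kap lin2 subsp_linearP !val_kap.
exists (kap v) => //; elim/subsp_Lin_ind: v {hv} => [|c u v Hu Hv|v [x [h vE]]].
- have -> : kap 0 = 0.
    by rewrite -[RHS](subrr (kap 0)) -scaleN1r addrC -kap_lin scaler0 addr0.
  exact: rpred0.
- by rewrite kap_lin rpredD // rpredZ.
- apply: mem_Lin; exists x, h; rewrite (_ : v = atom h); last exact: val_inj.
  by apply: val_inj; rewrite val_kap.
Qed.

End Fiber.
End ReproducingKernel.

(** * Translations of sections *)

Section Casts.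
Variables (R : realType) (k : RorC).
Local Notation hilbert := (hilbert R k).

Lemma hcast_linear (H1 H2 : hilbert) (e : H1 = H2) : linear (hcast e).
Proof. by case: _ / e. Qed.

Lemma hcast_trans (H1 H2 H3 : hilbert) (e : H1 = H2) (e' : H2 = H3) h :
  hcast e' (hcast e h) = hcast (etrans e e') h.
Proof. by case: _ / e'; case: _ / e. Qed.

Lemma hcast_dot (H1 H2 : hilbert) (e : H1 = H2) h h' :
  hdot H2 (hcast e h) h' = hdot H1 h (hcast (esym e) h').
Proof. by case: _ / e h'. Qed.

Lemma hcast_family (T : Type) (H : T -> hilbert) (f : forall x, H x) (H0 : hilbert)
    (x y : T) (ex : H x = H0) (ey : H y = H0) :
  x = y -> hcast ex (f x) = hcast ey (f y).
Proof. by move=> xy; case: _ / xy ey => ey; rewrite (Prop_irrelevance ex ey). Qed.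

End Casts.

Section Homs.
Variable G : star_semigroupoid.

Lemma homset_inj (s t : symb G) (g h : homset s t) : sval g = sval h -> g = h.
Proof. by case: g h => [g pg] [h ph] /= gh; exact: eq_exist. Qed.

Lemma fiber_inj (X : Type) (A : left_action G X) (s : symb G) (x y : fiber A s) :
  sval x = sval y -> x = y.
Proof. by case: x y => [x px] [y py] /= xy; exact: eq_exist. Qed.

Lemma hstarK (s t : symb G) (g : homset s t) : hstar (hstar g) = g.
Proof. by apply: homset_inj; exact: starK. Qed.

Lemma hstar_hmul (r s t : symb G) (g : homset s t) (h : homset r s) :
  hstar (hmul g h) = hmul (hstar h) (hstar g).
Proof. by apply: homset_inj; exact: star_mul. Qed.

Lemma fact_hmul (X : Type) (A : left_action G X) (r s t : symb G)
    (g : homset s t) (h : homset r s) (x : fiber A r) :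
  fact (hmul g h) x = fact g (fact h x).
Proof. by apply: fiber_inj; exact: act_mul. Qed.

End Homs.

Section KreinDensity.
Variables (R : realType) (k : RorC) (K : krein R k).

Lemma strong_densityP (D : submodClosed K) :
  strong_closure [set` D] = setT <->
  forall f e, 0 < e -> exists2 g, g \in D & sqnorm (kdot K) (f - g) < e.
Proof.
have hq := sqnorm_quadratic (kdot K).
split=> [dD f e e0|dD].
  have : strong_closure [set` D] f by rewrite dD.
  move=> /(_ (Num.sqrt e)); rewrite sqrtr_gt0 => /(_ e0)[g gD].
  rewrite (qnorm_lt hq) ?sqrtr_gt0 // sqr_sqrtr ?ltW // => fg.
  by exists g.
apply/seteqP; split=> // f _ e e0.
have [g gD fg] := dD f _ (exprn_gt0 2 e0).
by exists g => //; rewrite (qnorm_lt hq).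
Qed.

(** If u is orthogonal to D for the Krein form then J u is orthogonal to D for
    the Hilbert inner product, so every g in D is at distance at least |J u|
    from J u. *)
Lemma kform_dense_inj (D : submodClosed K) (z z' : K) : dense_subspace D ->
  (forall h : subsp D, kform K (val h) z = kform K (val h) z') -> z = z'.
Proof.
move=> /strong_densityP dD zz'; apply/eqP; rewrite -subr_eq0; apply/eqP.
set u := z - z'; have hq := sqnorm_quadratic (kdot K).
suff Ju : ksym K u = 0 by rewrite -(ksymK K u) Ju linear0.
apply: (sqnorm_eq0 (ip := kdot K)); apply/eqP; rewrite eq_le quad_ge0 // andbT.
apply/ler_addgt0Pr => e e0; rewrite add0r.
have [g gD] := dD (ksym K u) e e0.
rewrite quadD (quadN hq) (balNr (polar_balanced hq)) sqnorm_polar kdotE ksymK.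
have -> : kform K u g = 0.
  rewrite hermC expr0 mul1r linearBr.
  have /= -> := zz' (exist (fun v => v \in D) g gD).
  by rewrite subrr rmorph0.
by rewrite raddf0; have := quad_ge0 hq g; lra.
Qed.

End KreinDensity.

Section Representation.
Variables (R : realType) (k : RorC) (G : star_semigroupoid) (X : Type).
Variables (A : left_action G X) (H : X -> hilbert R k) (eH : bundle_invariant A H).
Variable K : kernel_family H.
Hypothesis invK : kernel_invariant eH K.
Local Notation F := (scal R k).
Local Notation conj := (@conjF R k).
Local Notation fiber := (fiber A).

(** Defined on all sections, so that on the span of kernel sections there is
    nothing to check about different expressions of the same section. *)
Definition translate (s t : symb G) (g : homset s t) (f : sections A H s) :
    sections A H t :=
  fun y => hcast (eH (hstar g) y) (f (fact (hstar g) y)).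

Lemma translate_linear (s t : symb G) (g : homset s t) : linear (translate g).
Proof.
move=> c u v; apply: functional_extensionality_dep => y; exact: hcast_linear.
Qed.

Lemma translate_hmul (r s t : symb G) (g : homset s t) (h : homset r s) f :
  translate (hmul g h) f = translate g (translate h f).
Proof.
apply: functional_extensionality_dep => y; rewrite /translate hcast_trans.
apply: (@hcast_family _ _ (fiber r) (fun x => H (sval x))).
by rewrite hstar_hmul fact_hmul.
Qed.

(** This is invariance of K for the arrow g^*, read as an identity of sections. *)
Lemma translate_kernel (s t : symb G) (g : homset s t) (x : fiber s) (h : H (sval x)) :
  translate g (kernel_section K h) =
  kernel_section K (hcast (esym (eH g x)) h) :> sections A H t.
Proof.
apply: functional_extensionality_dep => y; rewrite /translate /kernel_section.
by rewrite invK hstarK.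
Qed.


Variable RK : forall s : symb G, rk_krein A K s.
Let KS (s : symb G) : krein R k := krein_of_rk (RK s).
Let V : operator_bundle A H KS := fun s x h => rk_section (RK s) h.
Local Notation D := (range_span V).

Lemma rk_section_linear (s : symb G) (x : fiber s) :
  (forall x y, linear (@K x y)) -> linear (@V s x).
Proof.
move=> linK c h h'; apply: val_inj; apply: functional_extensionality_dep => y.
exact: linK.
Qed.

Lemma range_span_mem (s : symb G) (x : fiber s) (h : H (sval x)) : V h \in D s.
Proof. by apply: mem_Lin; exists x, h. Qed.

Lemma range_span_ind (s : symb G) (P : subsp (D s) -> Prop) :
  P 0 -> (forall c u v, P u -> P v -> P (c *: u + v)) ->
  (forall (v : subsp (D s)) (x : fiber s) (h : H (sval x)), val v = V h -> P v) ->
  forall v, P v.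
Proof.
move=> P0 PD PV; apply: subsp_Lin_ind => // v [x [h vE]]; exact: PV vE.
Qed.

Lemma rk_translation (s t : symb G) (g : homset s t) :
  exists T : {linear subsp (D s) -> KS t},
  forall v, val (T v) = translate g (val (val v)).
Proof.
have val2_linear c (u v : subsp (D s)) :
    val (val (c *: u + v)) = c *: val (val u) + val (val v) by rewrite !subsp_linearP.
have mem (v : subsp (D s)) : translate g (val (val v)) \in rk_space (RK t).
  elim/range_span_ind: v => [|c u v Hu Hv|v x h ->].
  - have tr0 : translate g (0 : sections A H s) = 0 :> sections A H t.
      exact: (linear0 (linear_of (@translate_linear s t g))).
    by rewrite !raddf0 tr0 rpred0.
  - by rewrite val2_linear translate_linear rpredD // rpredZ.
  - by rewrite translate_kernel; exact: rk_mem.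
pose T (v : subsp (D s)) : KS t := exist (fun f => f \in rk_space (RK t)) _ (mem v).
have linT : linear T.
  move=> c u v; apply: val_inj; rewrite [RHS]subsp_linearP.
  have valT w : val (T w) = translate g (val (val w)) by [].
  by rewrite !valT val2_linear translate_linear.
by exists (linear_of linT).
Qed.

Hypothesis denseD : forall s, dense_subspace (D s).

(** The representation is by translations.  The adjoint relation reduces, by
    the reproducing property, to (g f)(y) = f(g^* . y); and the values of an
    adjoint are unique because the domains are dense. *)
Lemma rk_representation_exists :
  exists Phi : forall s t : symb G, homset s t -> {linear subsp (D s) -> KS t},
    gen_star_representation Phi /\ intertwines eH V Phi.
Proof.
pose Phi (s t : symb G) (g : homset s t) : {linear subsp (D s) -> KS t} :=
  sval (cid (rk_translation g)).
have PhiE s t (g : homset s t) v : val (Phi s t g v) = translate g (val (val v)).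
  exact: (svalP (cid (rk_translation g))).
have PhiV s t (g : homset s t) v (x : fiber s) (h : H (sval x)) : val v = V h ->
    Phi s t g v = V (hcast (esym (eH g x)) h).
  by move=> vE; apply: val_inj; rewrite PhiE vE translate_kernel.
have Phi_mem s t (g : homset s t) v : Phi s t g v \in D t.
  elim/range_span_ind: v => [|c u v Hu Hv|v x h vE].
  - by rewrite linear0 rpred0.
  - by rewrite linearP rpredD // rpredZ.
  - by rewrite (PhiV _ _ _ _ _ _ vE) range_span_mem.
have Phi_adj s t (g : homset s t) (v : subsp (D t)) :
    krein_adj (Phi s t g) (val v) (Phi t s (hstar g) v).
  elim/range_span_ind: v => [|c u v Hu Hv|v y h vE] w.
  - by rewrite !linear0.
  - by rewrite subsp_linearP !linearP /= Hu Hv.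
  - rewrite (PhiV _ _ _ _ _ _ vE) vE /V /rk_section -!rk_reproducing PhiE.
    by rewrite hcast_dot.
exists Phi; split; [split|] => //.
- move=> s t g; have adj x (xD : x \in D t) :=
    Phi_adj s t g (exist (fun v => v \in D t) x xD).
  split=> [v|x xD|x z xD hz]; [exact: Phi_mem|by eexists; exact: (adj x xD)|].
  suff -> : z = Phi t s (hstar g) (exist (fun v => v \in D t) x xD) by exact: Phi_mem.
  by apply: (kform_dense_inj (@denseD s)) => h; rewrite -(adj x xD) -hz.
- by move=> r s t g h v w vw; apply: val_inj; rewrite !PhiE vw PhiE translate_hmul.
- move=> s t g x h.
  exists (exist (fun v => v \in D s) (V h) (range_span_mem h)) => //.
  exact: PhiV.
Qed.

End Representation.

(** * Adjoints, and the majorant given by a linearisation *)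

Section Adjoints.
Variables (R : realType) (k : RorC).
Local Notation F := (scal R k).
Local Notation conj := (@conjF R k).

Lemma dot_ext (V : lmodType F) (ip : {dot V for conj}) (u v : V) :
  (forall w, ip u w = ip v w) -> u = v.
Proof.
move=> uv; apply/eqP; rewrite -subr_eq0; apply/eqP.
by apply: (sqnorm_eq0 (ip := ip)); rewrite /sqnorm linearBl /= uv subrr raddf0.
Qed.

Lemma dot_ge0 (V : lmodType F) (ip : {dot V for conj}) (u : V) : 0 <= ip u u.
Proof.
have [->|u0] := eqVneq u 0; first by rewrite linear0l.
exact/ltW/(neq0_dnorm_gt0 (s := ip)).
Qed.

(** The Riesz theorem represents the real part; replacing h by conj c *: h gives
    the real parts of all scalar multiples, hence the scalar identity. *)
Lemma adjoint_exists (H : hilbert R k) (W : lmodType F) (ip : {dot W for conj})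
    (T : H -> W) (w : W) : bounded_linear (hdot H) ip T ->
  exists z, forall h, hdot H z h = ip w (T h).
Proof.
move=> /bounded_linearP[linT [C TC]].
have TZ := scalable_linear linT.
have TD u v : T (u + v) = T u + T v by have := linT 1 u v; rewrite !scale1r.
have [|||z zE] := @riesz _ _ _ _ (sqnorm_quadratic (hdot H))
  (fun h => reF (ip w (T h))) (sqnorm ip w) C.
- by apply/ip_completeP; exact: hcomplete.
- split=> [u v|r v]; first by rewrite TD linearDr raddfD.
  by rewrite TZ linearZr_LR /= conj_ofR reF_ofRM.
- move=> h; have := polar_le (sqnorm_quadratic ip) w (T h).
  rewrite sqnorm_polar ler_norml => /andP[_]; have := TC h; lra.
exists z => h; apply: reF_ext => c.
have -> : c * hdot H z h = hdot H z (conj c *: h) by rewrite linearZr_LR /= conjFK.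
have -> : c * ip w (T h) = ip w (conj c *: T h) by rewrite linearZr_LR /= conjFK.
by rewrite -TZ -zE sqnorm_polar.
Qed.

(** S is the operator T^* T'; Cauchy-Schwarz for |S h'|^2 = <T' h', T (S h')>
    bounds it. *)
Lemma adjoint_bounded (H H' : hilbert R k) (W : lmodType F) (ip : {dot W for conj})
    (T : H -> W) (T' : H' -> W) (S : H' -> H) :
  bounded_linear (hdot H) ip T -> bounded_linear (hdot H') ip T' ->
  (forall h' h, hdot H (S h') h = ip (T' h') (T h)) ->
  bounded_linear (hdot H') (hdot H) S.
Proof.
move=> /bounded_linearP[linT [C TC]] /bounded_linearP[linT' [C' TC']] SE.
apply/bounded_linearP; split=> [c u v|].
  by apply: (dot_ext (ip := hdot H)) => h; rewrite SE linT' !linearPl /= !SE.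
exists (`|C| * `|C'|) => h'; have hqH := sqnorm_quadratic (hdot H).
have hq := sqnorm_quadratic ip; set n := sqnorm (hdot H) (S h').
have n0 : 0 <= n by exact: (quad_ge0 hqH).
have := cauchy_schwarz hq (T' h') (T (S h')).
rewrite sqnorm_polar -SE -/(sqnorm _ _) -/n => h.
have [->|n_neq0] := eqVneq n 0.
  by rewrite !mulr_ge0 // (quad_ge0 (sqnorm_quadratic (hdot H'))).
have n_gt0 : 0 < n by rewrite lt_neqAle eq_sym n_neq0.
have qT : sqnorm ip (T (S h')) <= `|C| * n.
  by apply: le_trans (TC _) _; rewrite ler_wpM2r // ler_norm.
have qT' : sqnorm ip (T' h') <= `|C'| * sqnorm (hdot H') h'.
  apply: le_trans (TC' _) _; rewrite ler_wpM2r ?ler_norm //.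
  exact: (quad_ge0 (sqnorm_quadratic (hdot H'))).
rewrite -(ler_pM2r n_gt0) -expr2; apply: le_trans h _.
rewrite -mulrA [leRHS]mulrAC [leRHS]mulrC.
apply: le_trans (ler_pM (quad_ge0 hq _) (quad_ge0 hq _) qT' qT) _.
by rewrite le_eqVlt; apply/orP; left; apply/eqP; ring.
Qed.

(** The images of the unit ball are weakly bounded, as <f, T h> = <z, h>, and
    so bounded. *)
Lemma hellinger_toeplitz (V W : lmodType F) (ipV : {dot V for conj})
    (ipW : {dot W for conj}) (T : V -> W) :
  ip_complete ipW -> linear T ->
  (forall f, exists z, forall h, ipW f (T h) = ipV z h) ->
  bounded_linear ipV ipW T.
Proof.
move=> /ip_completeP cW linT adjT.
have TZ := scalable_linear linT.
have hqV := sqnorm_quadratic ipV; have hqW := sqnorm_quadratic ipW.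
have [|C CP] := uniform_boundedness hqW
    (g := fun h : {h | sqnorm ipV h <= 1} => T (sval h)) cW.
  move=> f; have [z zE] := adjT f; exists (sqnorm ipV z + 1) => -[h h1] /=.
  rewrite sqnorm_polar zE -sqnorm_polar.
  have := polar_le hqV z h; rewrite normrM ger0_norm //.
  have := quad_ge0 hqV z; have := normr_ge0 (polar (sqnorm ipV) z h); lra.
apply/bounded_linearP; split=> //; exists C => h.
have [h0|h_neq0] := eqVneq (sqnorm ipV h) 0.
  have T0 : T 0 = 0 by have := TZ 0 0; rewrite /= !scale0r.
  by rewrite h0 (sqnorm_eq0 h0) T0 mulr0 (quad0 hqW).
set n := sqnorm ipV h; have n_gt0 : 0 < n.
  by rewrite lt_neqAle eq_sym h_neq0; exact: (quad_ge0 hqV).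
pose r := (Num.sqrt n)^-1; have r2 : r ^+ 2 = n^-1.
  by rewrite exprVn sqr_sqrtr // ltW.
have rh : sqnorm ipV (ofR k r *: h) <= 1.
  by rewrite (quadR hqV) r2 mulVf // gt_eqF.
have := CP (exist (fun h => sqnorm ipV h <= 1) _ rh); rewrite /= TZ (quadR hqW) r2 mulrC.
by rewrite ler_pdivrMr.
Qed.

End Adjoints.

Section Linearisation.
Variables (R : realType) (k : RorC) (G : star_semigroupoid) (X : Type).
Variables (A : left_action G X) (H : X -> hilbert R k) (eH : bundle_invariant A H).
Variable K : kernel_family H.
Local Notation F := (scal R k).
Local Notation conj := (@conjF R k).
Local Notation fiber := (fiber A).

Lemma rk_section_bounded (s : symb G) (RK : rk_krein A K s) (x : fiber s) :
  linear (fun h : H (sval x) => rk_section RK h) ->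
  bounded_linear (hdot (H (sval x))) (kdot (krein_of_rk RK))
    (fun h : H (sval x) => rk_section RK h).
Proof.
move=> linV; apply: hellinger_toeplitz => //; first exact: kcomplete.
move=> f; exists (val (ksym (krein_of_rk RK) f) x) => h.
by rewrite kdotE rk_reproducing.
Qed.

Section Invariance.
Variables (KS : symb G -> krein R k) (D : forall s, submodClosed (KS s)).
Variables (V : operator_bundle A H KS).
Variable Phi : forall s t : symb G, homset s t -> {linear subsp (D s) -> KS t}.
Hypotheses (linV : krein_linearisation K V) (repPhi : gen_star_representation Phi).
Hypothesis intV : intertwines eH V Phi.

(** Both sides are [V_y h, Phi(g) V_x h'] = [Phi(star g) V_y h, V_x h']. *)
Lemma linearisation_invariant : kernel_invariant eH K.
Proof.
move=> s t g x y h; apply: (dot_ext (ip := hdot (H (sval x)))) => h'.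
have [_ linVE] := linV; have [_ _ _ adj] := repPhi.
rewrite hcast_dot linVE linVE.
have [v vE PhiV] := intV g h'; have [w wE PhiW] := intV (hstar g) h.
rewrite -PhiV -PhiW -vE -wE hermC [RHS]hermC; congr (_ * conjF _).
exact: adj.
Qed.

End Invariance.

Section Majorant.
Variables (KS : symb G -> krein R k) (V : operator_bundle A H KS).
Hypotheses (hK : partially_hermitian A K) (linV : krein_linearisation K V).

(** Says that z = V_x^* V_y h'.  Quantifying over s and over the proofs that x
    and y lie over s avoids transporting vectors between the spaces KS s. *)
Definition fiber_adjoint (x y : X) (h' : H y) (z : H x) :=
  forall s (px : anchor A x = s) (py : anchor A y = s) h,
    hdot (H x) z h = kdot (KS s) (@V s (exist _ y py) h') (@V s (exist _ x px) h).

Lemma fiber_adjoint_exists (x y : X) (h' : H y) : anchor A x = anchor A y ->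
  exists z, fiber_adjoint (x := x) h' z.
Proof.
move=> e; have [z zE] := @adjoint_exists _ _ (H x) _ (kdot (KS (anchor A y)))
   (@V _ (exist _ x e)) (@V _ (exist _ y erefl) h') (linV.1 _ (exist _ x e)).
exists z => s px py h; case: _ / py px => px.
by rewrite (Prop_irrelevance px e).
Qed.

(** The kernel V_x^* V_y, extended by 0 to pairs of points in different fibres. *)
Definition majorant : kernel_family H := fun x y h' =>
  match pselect (anchor A x = anchor A y) with
  | left e => sval (cid (fiber_adjoint_exists h' e))
  | right _ => 0
  end.

Lemma majorantE (s : symb G) (x y : fiber s) h h' :
  hdot (H (sval x)) (@majorant (sval x) (sval y) h') h =
  kdot (KS s) (V h') (V h).
Proof.
case: x y h h' => x px [y py] /= h h'; rewrite /majorant; case: pselect => [e|[]].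
  by rewrite (svalP (cid (fiber_adjoint_exists h' e)) s px py).
by rewrite px py.
Qed.

Lemma majorant_operator_valued : operator_valued majorant.
Proof.
move=> x y; have [e|ne] := pselect (anchor A x = anchor A y).
  have [bV _] := linV.
  apply: (adjoint_bounded (bV _ (exist _ x e)) (bV _ (exist _ y erefl))) => h' h.
  exact: (@majorantE _ (exist _ x e) (exist _ y erefl)).
have L0 h : @majorant x y h = 0 by rewrite /majorant; case: pselect.
apply/bounded_linearP; split=> [c u v|].
  by rewrite !L0 scaler0 addr0.
exists 0 => v; rewrite L0 mul0r /sqnorm linear0l raddf0 //.
Qed.

(** Expanding <u - J u, u - J u>_J gives twice the difference of the two sides. *)
Lemma kform_le_kdot (W : krein R k) (u : W) : kform W u u <= kdot W u u.
Proof.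
have dJ x y : kdot W (ksym W x) y = kform W x y by rewrite kdotE ksymK.
have dC x y : kdot W x y = conj (kdot W y x) by rewrite hermC expr0 mul1r.
have fC x y : kform W x y = conj (kform W y x) by rewrite hermC expr0 mul1r.
have := dot_ge0 (kdot W) (u - ksym W u).
rewrite linearBl !linearBr /= !dJ (dC u (ksym W u)) dJ -fC.
rewrite [kform W u (ksym W u)]fC -kdotE -dC opprB -mulr2n pmulrn_lge0 //.
by rewrite subr_ge0.
Qed.

Lemma hermitian_sum (n : nat) (W : krein R k) (f : {hermitian_sym W for conj})
    (w : 'I_n -> W) :
  \sum_i \sum_j f (w i) (w j) = f (\sum_i w i) (\sum_j w j).
Proof.
rewrite linear_sumlz; apply: eq_bigr => i _; by rewrite linear_sumr.
Qed.

Lemma majorant_positive : partially_positive A majorant.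
Proof.
split; first split; first exact: majorant_operator_valued.
  by move=> s x y h h'; rewrite majorantE hermC [RHS]hermC /= majorantE.
move=> s n x h; under eq_bigr do under eq_bigr do rewrite majorantE.
rewrite (hermitian_sum (kdot (KS s)) (fun i => V (h i))); exact: dot_ge0.
Qed.

Lemma majorant_ge : kernel_le A K majorant.
Proof.
have [bK hermK] := hK; have [bL hermL] := majorant_positive.1.
split; first split.
- move=> x y; have /bounded_linearP[linKxy [C CP]] := bK x y.
  have /bounded_linearP[linLxy [C' CP']] := bL x y.
  apply/bounded_linearP; split=> [c u v|].
    by rewrite linKxy linLxy scalerBr opprD addrACA.
  exists (2 * (C + C')) => v; have hq := sqnorm_quadratic (hdot (H x)).
  have := quad_par hq (majorant x v) (K x v).
  have := quad_ge0 hq (majorant x v + K x v).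
  have := CP v; have := CP' v; lra.
- by move=> s x y h h'; rewrite linearBl linearBr /= hermK hermL.
move=> s n x h; pose v := \sum_i V (h i).
suff -> : \sum_i \sum_j hdot (H (sval (x j))) (majorant (sval (x j)) (h i) -
    K (sval (x j)) (h i)) (h j) = kdot (KS s) v v - kform (KS s) v v.
  by rewrite subr_ge0 kform_le_kdot.
rewrite -(hermitian_sum (kdot (KS s))) -(hermitian_sum (kform (KS s))) -sumrB.
apply: eq_bigr => i _; rewrite -sumrB; apply: eq_bigr => j _.
by rewrite linearBl /= majorantE linV.2.
Qed.

End Majorant.
End Linearisation.

(** * The equivalence *)

Theorem theorem4p15 (R : realType) (k : RorC) (G : star_semigroupoid)
    (X : Type) (X_inh : inhabited X) (A : left_action G X)
    (H : X -> hilbert R k) (eH : bundle_invariant A H)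
    (K : kernel_family H) (hK : partially_hermitian A K) :
  let invariant_majorised :=
    kernel_invariant eH K /\
    exists L : kernel_family H, partially_positive A L /\ kernel_le A K L in
  let rk_representation :=
    exists RK : forall s : symb G, rk_krein A K s,
    let V : operator_bundle A H (fun s => krein_of_rk (RK s)) :=
      fun s x h => rk_section (RK s) h in
    exists Phi : forall s t : symb G, homset s t ->
        {linear subsp (range_span V s) -> krein_of_rk (RK t)},
      gen_star_representation Phi /\ intertwines eH V Phi in
  let invariant_linearisation :=
    exists (KS : symb G -> krein R k) (D : forall s, submodClosed (KS s))
      (V : operator_bundle A H KS)
      (Phi : forall s t : symb G, homset s t -> {linear subsp (D s) -> KS t}),
      (krein_linearisation K V /\ minimal_linearisation V) /\
      (gen_star_representation Phi /\ intertwines eH V Phi) in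
  (invariant_majorised <-> rk_representation) /\
  (rk_representation <-> invariant_linearisation).
Proof.
move=> invariant_majorised rk_representation invariant_linearisation.
have linK x y : linear (K x y) by have /bounded_linearP[] := hK.1 x y.
have rk_of_majorised : invariant_majorised -> rk_representation.
  move=> [invK [L [posL leKL]]].
  have linL x y : linear (L x y) by have /bounded_linearP[] := posL.1.1 x y.
  have rkP s := rk_krein_exists s linK linL hK posL leKL.
  pose RK s := sval (cid (rkP s)); exists RK => V.
  have denseV s : dense_subspace (range_span V s).
    apply/strong_densityP => f e e0; exact: (svalP (cid (rkP s)) f e e0).
  exact: (rk_representation_exists invK denseV).
have linearisation_of_rk : rk_representation -> invariant_linearisation.
  move=> [RK [Phi [repPhi intPhi]]].
  exists (fun s => krein_of_rk (RK s)), (range_span (fun s x h => rk_section (RK s) h)),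
    (fun s x h => rk_section (RK s) h), Phi; split=> //; split; last by case: repPhi.
  split=> [s x|s x y h h'].
    apply: rk_section_bounded; exact: rk_section_linear linK.
  by rewrite -rk_reproducing.
have majorised_of_linearisation : invariant_linearisation -> invariant_majorised.
  move=> [KS [D [V [Phi [[linV minV] [repPhi intPhi]]]]]]; split.
    exact: (linearisation_invariant linV repPhi intPhi).
  exists (majorant linV); split; first exact: majorant_positive.
  exact: majorant_ge.
by split; split=> // ?; auto.
Qed.
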